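(* Let $B=B^{r_k,s_k}\otimes\cdots\otimes B^{r_1,s_1}$ be a tensor product of Kirillov-Reshetikhin crystals of type $A_n^{(1)}$ and let $m\in\mathbb{Z}_{>0}$. Under the Kirillov-Schilling-Shimozono bijection $\Phi$, the similarity map $S_m$ on paths corresponds to the similarity map $S_m$ on rigged configurations; that is, $$\Phi(S_m(b))=S_m(\Phi(b))\qquad\text{for all } b\in\mathcal{P}(B),$$ where on the left $\Phi:\mathcal{P}(S_m(B))\to\mathcal{RC}(L(S_m(B)))$ and on the right $\Phi:\mathcal{P}(B)\to\mathcal{RC}(L(B))$.
   Context: **Paths.** Fix $n\ge 1$ and put $I_0=\{1,\dots,n\}$. For $r\in I_0$, $s\in\mathbb{Z}_{>0}$, $B^{r,s}$ is, as a set, the set of semistandard tableaux (rows weakly increasing, columns strictly increasing downwards) of rectangular shape with $r$ rows and $s$ columns and letters in $\{1,\dots,n+1\}$. Elements of $B=B^{r_k,s_k}\otimes\cdots\otimes B^{r_1,s_1}$ are $b=b_k\otimes\cdots\otimes b_1$ with $b_j\in B^{r_j,s_j}$. For a tableau $T$, $row(T)$ is the word obtained by reading the rows from bottom to top, each row from left to right, and $row(b)=row(b_k)\cdots row(b_1)$. The set $\mathcal{P}(B)$ of (highest-weight) paths is the set of $b\in B$ with $e_ib=0$ for all $i\in I_0$ ($e_i$ the Kashiwara operators, with the anti-Kashiwara tensor product convention, acting on tableaux through row words); explicitly, $b\in\mathcal{P}(B)$ iff for each $i\in I_0$ every suffix of $row(b)$ contains at least as many letters $i$ as letters $i+1$.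 Operations on paths (they send paths to paths): - $\mathrm{lh}$: for $B=B^{1,1}\otimes B'$, $\mathrm{lh}(c\otimes b')=b'$ and $\mathrm{lh}(B)=B'$. - $\mathrm{lb}$: for $B=B^{r,1}\otimes B'$ with $r\ge 2$, $\mathrm{lb}(c\otimes b')=c'\otimes c''\otimes b'$ where $c'$ is the lowest row (box) of $c$ and $c''$ is $c$ with $c'$ removed; $\mathrm{lb}(B)=B^{1,1}\otimes B^{r-1,1}\otimes B'$. - $\mathrm{ls}$: for $B=B^{r,s}\otimes B'$ with $s\ge2$, $\mathrm{ls}(c\otimes b')=c'\otimes c''\otimes b'$ where $c'$ is the leftmost column of $c$ and $c''$ is $c$ with $c'$ removed; $\mathrm{ls}(B)=B^{r,1}\otimes B^{r,s-1}\otimes B'$. **Rigged configurations.** Let $C_{ab}=2\delta_{a,b}-\delta_{a,b+1}-\delta_{a,b-1}$ ($a,b\in I_0$). A multiplicity array is a matrix $L=(L_i^{(a)})_{a\in I_0,i\in\mathbb{Z}_{>0}}$ of nonnegative integers, almost all zero. Another such matrix $\nu=(m_i^{(a)})$ is an admissible configuration if all vacancy numbers $$p_i^{(a)}=\sum_{j>0}\Big(L_j^{(a)}\min(i,j)-\sum_{b\in I_0}C_{ab}\min(i,j)m_j^{(b)}\Big)$$ are $\ge 0$ ($a\in I_0$, $i\in\mathbb{Z}_{>0}$). Identify $\nu$ with the sequence of partitions (Young diagrams) $\nu^{(a)}$ having $m_i^{(a)}$ rows of length $i$, and likewise $L$ with partitions $L^{(a)}$ having $L_i^{(a)}$ rows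 of length $i$. A rigging $J$ on $\nu$ assigns to each $(a,i)$ a sequence of integers $p_i^{(a)}\ge J_1^{(a,i)}\ge\cdots\ge J^{(a,i)}_{m_i^{(a)}}\ge0$, attached to the rows of length $i$ of $\nu^{(a)}$. $(\nu,J)$ is a rigged configuration; $\mathcal{RC}(L)$ is the set of all of them with multiplicity array $L$. A row of length $i$ in $\nu^{(a)}$ is singular if its rigging equals $p_i^{(a)}$. For $B=B^{r_k,s_k}\otimes\cdots\otimes B^{r_1,s_1}$, the multiplicity array $L(B)=(L_i^{(a)})$ is given by $L_i^{(a)}=\sharp\{j\mid(r_j,s_j)=(a,i),\ 1\le j\le k\}$. Operations on rigged configurations (they send $\mathcal{RC}(L)$ to $\mathcal{RC}(\tilde L)$; unless otherwise stated, riggings are unchanged and ''singular'' for new rows is with respect to the new vacancy numbers): - $\delta$ (when $L^{(1)}$ has a row of length 1): set $\ell^{(0)}=1$; for $a=1,2,\dots,n$ find the smallest $i\ge\ell^{(a-1)}$ such that $\nu^{(a)}$ has a singular row of length $i$; if none exists stop, otherwise set $\ell^{(a)}=i$ and select such a row, and continue with $a+1$. $\tilde L$ is $L$ with one row of length 1 removed from $L^{(1)}$; $\delta(\nu,J)$ is obtained by removing one box from each selected row and making the resulting rows singular. - $\beta$ (when $L^{(r)}$, $r\ge2$, has a row of length 1): $\tilde L$ is obtained by removing a row of length 1 from $L^{(r)}$ and adding a row of length 1 to each of $L^{(1)}$ and $L^{(r-1)}$ (two rows to $L^{(1)}$ if $r=2$); $\beta(\nu,J)$ is obtained by adding a singular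 row of length 1 to $\nu^{(a)}$ for each $1\le a<r$. - $\gamma$ (when $L^{(r)}$ has a row of length $s\ge2$): $\tilde L$ is obtained by replacing a row of length $s$ in $L^{(r)}$ by a row of length $1$ and a row of length $s-1$; $\gamma(\nu,J)=(\nu,J)$. **The bijection $\Phi$.** It is known (Kirillov-Schilling-Shimozono) that there is a unique family of bijections $\Phi:\mathcal{P}(B)\to\mathcal{RC}(L(B))$, over all $B$, mapping the empty path to the empty rigged configuration and such that $\Phi\circ\mathrm{lh}=\delta\circ\Phi$ if $B=B^{1,1}\otimes B'$; $\Phi\circ\mathrm{lb}=\beta\circ\Phi$ if $B=B^{r,1}\otimes B'$, $r\ge2$; $\Phi\circ\mathrm{ls}=\gamma\circ\Phi$ if $B=B^{r,s}\otimes B'$, $s\ge2$ (with $\beta,\gamma$ applied to the row of $L(B)$ corresponding to the leftmost factor of $B$). **Similarity maps.** For a tableau $T\in B^{r,s}$, $S_m(T)\in B^{r,ms}$ is obtained by replacing, in each row, each box with letter $a$ by $m$ boxes with the same letter $a$. For $b=b_k\otimes\cdots\otimes b_1$, $S_m(b)=S_m(b_k)\otimes\cdots\otimes S_m(b_1)$, and $S_m(B)=B^{r_k,ms_k}\otimes\cdots\otimes B^{r_1,ms_1}$; $S_m$ maps $\mathcal{P}(B)$ to $\mathcal{P}(S_m(B))$. On rigged configurations, $S_m$ multiplies the length of every row of all $L^{(a)}$ and $\nu^{(a)}$ by $m$ and multiplies every rigging by $m$. *)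

(* Defs.v *)
From HB Require Import structures.
From mathcomp Require Import all_boot all_order all_algebra.
From mathcomp Require Import finmap multiset.
From mathcomp Require Import boolp classical_sets functions.

Set Implicit Arguments.
Unset Strict Implicit.
Unset Printing Implicit Defensive.

Import Order.TTheory GRing.Theory Num.Theory.

Local Open Scope mset_scope.
Local Open Scope nat_scope.

(** Tensor products of KR crystals and paths, type [A_n^(1)].

    All indices are 1-based natural numbers, as in the mathematics: nodes and
    heights range over [1..n], letters over [1..n+1].  A tensor product
    [B^{r_k,s_k} (x) ... (x) B^{r_1,s_1}] is the list
    [:: (r_k, s_k); ...; (r_1, s_1)], leftmost factor first, and an element
    [b_k (x) ... (x) b_1] is the list [:: b_k; ...; b_1]. *)

Definition crystal := seq (nat * nat).

(* The list of the rows, from top to bottom. *)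
Definition tableau := seq (seq nat).

Definition wf_factor (n : nat) (q : nat * nat) : bool :=
  (1 <= q.1 <= n) && (1 <= q.2).

Definition wf_crystal (n : nat) (B : crystal) : bool := all (wf_factor n) B.

(* [T] is an element of [B^{q.1,q.2}]. *)
Definition is_tableau (n : nat) (q : nat * nat) (T : tableau) : bool :=
  [&& size T == q.1,
      all (fun w => [&& size w == q.2, sorted leq w
                      & all (fun c => 1 <= c <= n.+1) w]) T
    & sorted (fun u v => all2 ltn u v) T].

Definition tableau_word (T : tableau) : seq nat := flatten (rev T).

Definition row_word (b : seq tableau) : seq nat :=
  flatten (map tableau_word b).

(* With the anti-Kashiwara convention, [e_i b = 0] iff every suffix of the row
   word of [b] contains at least as many letters [i] as letters [i+1]. *)
Definition highest_weight (n : nat) (b : seq tableau) : Prop :=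
  forall i k : nat, 1 <= i <= n ->
    count_mem i.+1 (drop k (row_word b)) <= count_mem i (drop k (row_word b)).

Definition paths (n : nat) (B : crystal) : set (seq tableau) :=
  fun b => all2 (is_tableau n) B b /\ highest_weight n b.

(* These maps are only meaningful on nonempty paths whose leftmost factor is of
   the appropriate shape: [B^{1,1}] for [lh], [B^{r,1}] with [r >= 2] for [lb],
   [B^{r,s}] with [s >= 2] for [ls]. *)
Definition lh (b : seq tableau) : seq tableau := behead b.

Definition lb (b : seq tableau) : seq tableau :=
  if b is c :: b' then [:: last [::] c] :: take (size c).-1 c :: b' else [::].

Definition ls (b : seq tableau) : seq tableau :=
  if b is c :: b' then map (take 1) c :: map behead c :: b' else [::].

(** Rigged configurations.

    A multiplicity array [L] is the finite multiset containing the pair [(a, i)]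
    with multiplicity [L_i^(a)], i.e. the multiset of all rows (of length [i])
    of all the partitions [L^(a)].  A configuration [nu] is encoded in the same
    way; with its rigging it is a multiset of triples [((a, i), x)], one for
    each row of length [i] of [nu^(a)], where [x] is the rigging of that row.
    The sequence [J^(a,i)] is the decreasing rearrangement of the [x] such that
    [((a, i), x)] occurs. *)

Notation row_mset := {mset nat * nat}.
Notation rigged_mset := {mset (nat * nat) * int}.

Record rigged_configuration := RiggedConfiguration {
  mult : row_mset;
  rigged : rigged_mset
}.

Definition config (J : rigged_mset) : row_mset := seq_mset (map fst J).

Definition cartan (a b : nat) : int :=
  ((a == b)%:Z *+ 2 - (a == b.+1)%:Z - (a.+1 == b)%:Z)%R.

(* The vacancy number [p_i^(a)].  A sum over [j] weighted by [L_j^(a)] (resp.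
   over [b] and [j] weighted by [m_j^(b)]) is a sum over the rows. *)
Definition vacancy (L nu : row_mset) (a i : nat) : int :=
  (\sum_(q <- L | q.1 == a) (minn i q.2)%:Z
   - \sum_(q <- nu) cartan a q.1 * (minn i q.2)%:Z)%R.

Definition row_vacancy (x : rigged_configuration) (a i : nat) : int :=
  vacancy (mult x) (config (rigged x)) a i.

Definition RC (n : nat) (L : row_mset) : set rigged_configuration :=
  fun x => [/\ mult x = L,
    forall y, y \in rigged x -> (1 <= y.1.1 <= n) && (1 <= y.1.2),
    forall a i, 1 <= a <= n -> 1 <= i -> (0 <= row_vacancy x a i)%R
  & forall y, y \in rigged x -> (0 <= y.2 <= row_vacancy x y.1.1 y.1.2)%R].

Definition crystal_mult (B : crystal) : row_mset := seq_mset B.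

(* The configuration obtained from [J] by adding the rows of [s], all singular
   with respect to the vacancy numbers of the result. *)
Definition add_singular (L : row_mset) (J : rigged_mset) (s : seq (nat * nat)) :
    rigged_configuration :=
  RiggedConfiguration L
    (J `+` seq_mset [seq (q, vacancy L (config J `+` seq_mset s) q.1 q.2)
                    | q <- s]).

(* The rows selected by [delta] in colours [a, ..., a + k - 1], as pairs
   (colour, length), when the lengths have to be at least [l]. *)
Fixpoint delta_select (x : rigged_configuration) (l a k : nat) :
    seq (nat * nat) :=
  if k is k'.+1 then
    if sort leq [seq y.1.2 | y <- rigged x &
          [&& y.1.1 == a, l <= y.1.2 & y.2 == row_vacancy x a y.1.2]] is i :: _
    then (a, i) :: delta_select x i a.+1 k'
    else [::]
  else [::].

Definition delta (n : nat) (x : rigged_configuration) : rigged_configuration :=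
  let sel := delta_select x 1 1 n in
  add_singular (mult x `\ (1, 1))
    (rigged x `\` seq_mset [seq (q, row_vacancy x q.1 q.2) | q <- sel])
    [seq (q.1, q.2.-1) | q <- sel & 1 < q.2].

Definition beta (r : nat) (x : rigged_configuration) : rigged_configuration :=
  add_singular ((mult x `\ (r, 1)) `+` [mset (1, 1); (r.-1, 1)]) (rigged x)
    [seq (a, 1) | a <- iota 1 r.-1].

Definition gamma (r s : nat) (x : rigged_configuration) :
    rigged_configuration :=
  RiggedConfiguration ((mult x `\ (r, s)) `+` [mset (r, 1); (r, s.-1)])
    (rigged x).

(** The Kirillov-Schilling-Shimozono bijection: [Phi] is the family of maps
    [P(B) -> RC(L(B))], over all [B] and for a fixed [n]. *)

Record is_KSS_bijection (n : nat)
    (Phi : crystal -> seq tableau -> rigged_configuration) : Prop := {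
  KSS_bij : forall B, wf_crystal n B ->
    set_bij (paths n B) (RC n (crystal_mult B)) (Phi B);
  KSS_empty : Phi [::] [::] = RiggedConfiguration mset0 mset0;
  KSS_lh : forall B' b,
    wf_crystal n ((1, 1) :: B') -> paths n ((1, 1) :: B') b ->
    Phi B' (lh b) = delta n (Phi ((1, 1) :: B') b);
  KSS_lb : forall r B' b, 2 <= r ->
    wf_crystal n ((r, 1) :: B') -> paths n ((r, 1) :: B') b ->
    Phi [:: (1, 1), (r.-1, 1) & B'] (lb b) = beta r (Phi ((r, 1) :: B') b);
  KSS_ls : forall r s B' b, 2 <= s ->
    wf_crystal n ((r, s) :: B') -> paths n ((r, s) :: B') b ->
    Phi [:: (r, 1), (r, s.-1) & B'] (ls b) = gamma r s (Phi ((r, s) :: B') b)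
}.

(** The similarity maps [S_m]. *)

Definition sim_crystal (m : nat) (B : crystal) : crystal :=
  [seq (q.1, m * q.2) | q <- B].

Definition sim_tableau (m : nat) (T : tableau) : tableau :=
  [seq flatten [seq nseq m c | c <- w] | w <- T].

Definition sim_path (m : nat) (b : seq tableau) : seq tableau :=
  map (sim_tableau m) b.

Definition sim_RC (m : nat) (x : rigged_configuration) : rigged_configuration :=
  RiggedConfiguration
    (seq_mset [seq (q.1, m * q.2) | q <- mult x])
    (seq_mset [seq ((y.1.1, m * y.1.2), (y.2 *+ m)%R) | y <- rigged x]).

(* Main.v *)
(* Removing the leftmost column of a factor [B^{r,k}] amounts to [gamma] followed
   by [r] times [delta \o beta]; the selected lengths of the successive deltas
   are nested, so the whole removal can be characterized by the vacancy numbers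
   before and after it. This characterization is stable under interpolation:
   removing one after the other the [m] copies of the column from the scaled
   configuration shortens each row by one box at each step and leads exactly to
   the scaling of the reduced configuration. By induction on the number of
   columns and by bijectivity of [Phi], the path [b''] with
   [Phi b'' = S_m (Phi b)] agrees with [S_m b] except possibly in the first [m]
   columns. Finally [Phi] preserves weights, which is forced by the bijectivity
   and the compatibility with [lh], [lb] and [ls]; hence the first [m] columns
   have the right content, which determines them. *)

Require Import Defs.
From mathcomp Require Import all_boot all_order all_algebra.
From mathcomp Require Import finmap multiset.
From mathcomp Require Import boolp classical_sets functions.
From mathcomp Require Import zify ring.

Set Implicit Arguments.
Unset Strict Implicit.
Unset Printing Implicit Defensive.

Import Order.TTheory GRing.Theory Num.Theory.

Local Open Scope mset_scope.
Local Open Scope nat_scope.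

(** * Rows, vacancy numbers and multisets *)

(** The obstacle is that [S_m] is not compatible with a single [delta]: one column becomes m
    columns, and the vacancy numbers met halfway through the removal of a column are not those of
    any scaled configuration. So only the two ends x and z of a whole column removal may be
    compared. This is possible because a row shortened during the removal of a column is not
    selected again. Row lengths then move by at most one unit, min(i, l) is linear along such a
    motion, and step t of the scaled removal has vacancy numbers (m - t) p_x + t p_z. An untouched
    rigging v satisfies v <= p_x and v <= p_z; if m v equals this mean with t < m, then v = p_x, so
    no untouched row becomes singular by accident. The clauses characterizing [Phi] never say which
    letter [delta] removes. One has to show that a box d selects d - 1 colours: columns bound this
    number from above, and injectivity excludes smaller values. The letter 1 needs another argument,
    by rows, because the column 1, ..., n + 1 is too high to be a factor. *)

Definition rows_with (f : nat -> nat -> int) (s : seq (nat * nat)) :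
    seq ((nat * nat) * int) :=
  [seq (q, f q.1 q.2) | q <- s].

Definition shrink (s : seq (nat * nat)) : seq (nat * nat) :=
  [seq (q.1, q.2.-1) | q <- s & 1 < q.2].

(* The lengths of a selection [s] enter all formulas through these booleans
   only; a colour that is not selected is never hit, which replaces the
   convention that its length is infinite. *)
Definition hit (s : seq (nat * nat)) (a i : nat) : bool :=
  has (fun q => (q.1 == a) && (q.2 <= i)) s.

(** Lists replace multisets here so that adding, shortening and scaling rows become concatenation
    and [map]. *)
Definition vac (l nu : seq (nat * nat)) (a i : nat) : int :=
  (\sum_(q <- l | q.1 == a) (minn i q.2)%:Z
   - \sum_(q <- nu) cartan a q.1 * (minn i q.2)%:Z)%R.

Lemma map_fst_rows_with f s : map fst (rows_with f s) = s.
Proof. by rewrite -map_comp map_id. Qed.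

Lemma eq_rows_with f g s :
  {in s, forall q, f q.1 q.2 = g q.1 q.2} -> rows_with f s = rows_with g s.
Proof. by move=> fg; apply/eq_in_map => q qs; rewrite fg. Qed.

Lemma mem_rows_with f s y :
  (y \in rows_with f s) = (y.1 \in s) && (y.2 == f y.1.1 y.1.2).
Proof.
apply/mapP/andP => [[q qs ->]|[ys /eqP]]; first by rewrite eqxx.
by move=> eqy; exists y.1; rewrite // -eqy; case: (y).
Qed.

Lemma hitP s a i : reflect (exists2 l, (a, l) \in s & l <= i) (hit s a i).
Proof.
apply: (iffP hasP) => [[[b l] bl /= /andP[/eqP <- li]]|[l al li]].
  by exists l.
by exists (a, l); rewrite //= eqxx.
Qed.

Lemma hit_le s a i j : i <= j -> hit s a i -> hit s a j.
Proof.
by move=> ij /hitP[l al li]; apply/hitP; exists l => //; apply: leq_trans ij.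
Qed.

Lemma vacancy_vac (L nu : row_mset) l s a i : perm_eq L l -> perm_eq nu s ->
  vacancy L nu a i = vac l s a i.
Proof. by move=> Ll ns; congr (_ - _)%R; apply: perm_big. Qed.

Lemma row_vacancy_vac (x : rigged_configuration) l s a i : perm_eq (mult x) l -> perm_eq (rigged x) s ->
  row_vacancy x a i = vac l (map fst s) a i.
Proof.
move=> xl xs; apply: vacancy_vac => //.
by rewrite (perm_trans (perm_eq_seq_mset _))// perm_map.
Qed.

Lemma perm_msetD (T : choiceType) (A B : {mset T}) : perm_eq (A `+` B) (A ++ B).
Proof.
apply/allP => z _ /=; rewrite count_cat !count_mem_mset msetE2.
by rewrite eqxx.
Qed.

Lemma seq_mset_cat (T : choiceType) (s t : seq T) :
  seq_mset (s ++ t) = seq_mset s `+` seq_mset t.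
Proof. by apply/msetP => z; rewrite msetE2 !mset_seqE count_cat. Qed.

Lemma config_seq_mset s : config (seq_mset s) = seq_mset (map fst s).
Proof. by apply/eq_seq_msetP/perm_map/perm_eq_seq_mset. Qed.

Lemma config_msetD J K : config (J `+` K) = config J `+` config K.
Proof.
rewrite -[J]seq_mset_id -[K]seq_mset_id -seq_mset_cat !config_seq_mset.
by rewrite map_cat seq_mset_cat.
Qed.

Lemma rigged_configuration_eq x y :
  mult x = mult y -> rigged x = rigged y -> x = y.
Proof. by case: x y => [L J] [L' J'] /= -> ->. Qed.

Lemma rigged_add_singular L J s (z := add_singular L J s) :
  rigged z = J `+` seq_mset (rows_with (row_vacancy z) s).
Proof.
rewrite {1}/z /=; congr (_ `+` seq_mset _); apply: eq_rows_with => q _.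
rewrite /row_vacancy /z /= config_msetD config_seq_mset.
by rewrite -/(rows_with (vacancy L (config J `+` seq_mset s)) s) map_fst_rows_with.
Qed.

Lemma uniq_sub_perm_cat (T : eqType) (s t : seq T) :
  uniq s -> {subset s <= t} -> exists r, perm_eq t (r ++ s).
Proof.
elim: s t => [|z s IHs] t /=; first by exists t; rewrite cats0.
case/andP=> zs us sub; have zt: z \in t by apply: sub; rewrite mem_head.
have [] := IHs (rem z t) us.
  move=> y ys; have yt: y \in t by apply: sub; rewrite inE ys orbT.
  have yz: y != z by apply: contraNneq zs => <-.
  move: yt; rewrite (perm_mem (perm_to_rem zt)) inE (negPf yz) //.
move=> r tr; exists r; rewrite (perm_trans (perm_to_rem zt))//.
by rewrite perm_sym (perm_catCA r [:: z] s)/= perm_cons perm_sym.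
Qed.

Lemma perm_cat_disjoint (T : eqType) (a b c d : seq T) :
  perm_eq (a ++ b) (c ++ d) -> {in b, forall z, z \notin d} ->
  exists2 e, perm_eq c (e ++ b) & perm_eq a (e ++ d).
Proof.
move=> /permP P dis.
have cnt z: count_mem z b <= count_mem z c.
  case zb: (z \in b); last by rewrite (count_memPn (negbT zb)).
  have := P (pred1 z); rewrite !count_cat (count_memPn (dis _ zb)) addn0 => <-.
  exact: leq_addl.
have [e' ce]: exists e', perm_eq c (e' ++ b).
  elim: b c cnt {P dis} => [|z b IHb] c cnt; first by exists c; rewrite cats0.
  have zc: z \in c by rewrite -has_pred1 has_count (leq_trans _ (cnt z))//= eqxx.
  have [y|r cr] := IHb (rem z c).
    have := cnt y; rewrite (permP (perm_to_rem zc)) /=; lia.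
  exists r; rewrite (perm_trans (perm_to_rem zc))//.
  by rewrite perm_sym (perm_catCA r [:: z] b)/= perm_cons perm_sym.
exists e' => //; apply/permP => p; have := P p; move/permP: ce => /(_ p).
rewrite !count_cat; lia.
Qed.

Lemma vac_perm l l' s s' a i : perm_eq l l' -> perm_eq s s' ->
  vac l s a i = vac l' s' a i.
Proof. by move=> ll ss; congr (_ - _)%R; apply: perm_big. Qed.

Lemma vac_cat l l' s s' a i :
  (vac (l ++ l') (s ++ s') a i = vac l s a i + vac l' s' a i)%R.
Proof. by rewrite /vac !big_cat /=; ring. Qed.

Lemma vac_catr l s t a i : (vac l (s ++ t) a i = vac l s a i + vac [::] t a i)%R.
Proof. by rewrite -vac_cat cats0. Qed.

Lemma vac_cons b j l s a i :
  (vac ((b, j) :: l) s a i = (b == a)%:Z * (minn i j)%:Z + vac l s a i)%R.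
Proof. by rewrite /vac big_cons /=; case: eqP => _; rewrite ?mul1r ?mul0r; ring. Qed.

Lemma sum_cartan_iota (a p : nat) : 0 < a ->
  (\sum_(b <- iota 1 p) cartan a b
   = (a == 1)%:Z + (a == p)%:Z - (a == p.+1)%:Z)%R.
Proof.
move=> a0; elim: p => [|p IHp]; first by rewrite big_nil; case: a a0 => // a _; lia.
have -> : iota 1 p.+1 = iota 1 p ++ [:: p.+1] by rewrite -[p.+1]addn1 iotaD add1n addn1.
rewrite big_cat /= IHp big_seq1 /cartan; lia.
Qed.

(** Taking a box from a row of length l lowers min(i, l) by 1 exactly when l <= i. There is at most
    one row per colour, so the Cartan matrix turns these changes into a second difference of [hit s]
    in the colour. *)
Lemma sum_cartan_hit (s : seq (nat * nat)) (a i : nat) :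
  uniq (map fst s) -> all (fun q => 0 < q.2) s -> 0 < a ->
  (\sum_(q <- s) cartan a q.1 * ((minn i q.2)%:Z - (minn i q.2.-1)%:Z)
   = 2%:Z * (hit s a i)%:Z - (hit s a.-1 i)%:Z - (hit s a.+1 i)%:Z)%R.
Proof.
move=> us s0 a0; elim: s us s0 => [|[b l] s IHs]; first by rewrite big_nil.
rewrite /= big_cons /= => /andP[bs us] /andP[l0 s0]; rewrite (IHs us s0).
have nh j: hit s b j = false.
  apply/negbTE/hitP => -[l' bl' _]; move/negP: bs; apply.
  by apply/mapP; exists (b, l').
have -> : ((minn i l)%:Z - (minn i l.-1)%:Z = (l <= i)%:Z :> int)%R by lia.
rewrite /hit /= -!/(hit s _ i) /cartan.
have [ba|ba] := eqVneq b a.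
  by subst b; rewrite nh; do 2 case: (hit s _ i); lia.
have [ba1|ba1] := eqVneq b a.-1.
  by rewrite -ba1 nh; do 2 case: (hit s _ i); lia.
have [ba2|ba2] := eqVneq b a.+1.
  by rewrite -ba2 nh; do 2 case: (hit s _ i); lia.
by do 3 case: (hit s _ i); lia.
Qed.

Lemma vac_shrink (s : seq (nat * nat)) (a i : nat) :
  uniq (map fst s) -> all (fun q => 0 < q.2) s -> 0 < a ->
  (vac [::] (shrink s) a i = vac [::] s a i
     + 2%:Z * (hit s a i)%:Z - (hit s a.-1 i)%:Z - (hit s a.+1 i)%:Z)%R.
Proof.
move=> us s0 a0; rewrite /vac !big_nil !sub0r big_map big_filter /=.
have -> : (\sum_(q <- s | (1 < q.2)%N) cartan a q.1 * (minn i q.2.-1)%:Z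
    = \sum_(q <- s) cartan a q.1 * (minn i q.2.-1)%:Z)%R.
  rewrite big_mkcond; apply: eq_bigr => -[b l] _ /=; case: ifP => //.
  by case: l => [|[|]]//; rewrite minn0 mulr0.
rewrite -(addrA _ (- _)%R) -(addrA _ _ (- _ - _))%R.
set S1 := (\sum_(q <- s) _)%R; set S2 := (\sum_(q <- s) _)%R.
have -> : S1 = (S2 - (S2 - S1))%R by ring.
rewrite -[(S2 - S1)%R]sumrB; have := sum_cartan_hit i us s0 a0.
under eq_bigr do rewrite mulrBr; move=> ->; ring.
Qed.

(** * Removal of a box *)

Definition singular (x : rigged_configuration) (a i : nat) : bool :=
  ((a, i), row_vacancy x a i) \in rigged x.

Variant delta_select_spec x l a k : seq (nat * nat) -> Prop :=
| DeltaSelectNone of (forall i, l <= i -> ~~ singular x a i) :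
    delta_select_spec x l a k [::]
| DeltaSelectSome i of l <= i & singular x a i
    & (forall j, l <= j -> singular x a j -> i <= j) :
    delta_select_spec x l a k ((a, i) :: delta_select x i a.+1 k).

Lemma delta_selectP x l a k :
  delta_select_spec x l a k (delta_select x l a k.+1).
Proof.
rewrite /=; set s := [seq y.1.2 | y <- _ & _].
have memS i : (i \in s) = (l <= i) && singular x a i.
  apply/mapP/andP => [[[[b j] v]]|[li si]].
    by rewrite mem_filter /= => /andP[/and3P[/eqP -> lj /eqP ->] yx] ->.
  by exists ((a, i), row_vacancy x a i); rewrite // mem_filter /= !eqxx li.
have: sorted leq (sort leq s) by apply: sort_sorted; apply: leq_total.
have memT i : (i \in sort leq s) = (l <= i) && singular x a i.
  by rewrite mem_sort.
case: (sort leq s) memT => [|i t] memT; last first.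
  move=> /= it; have := memT i; rewrite mem_head => /esym/andP[li si].
  apply: DeltaSelectSome => // j lj sj.
  have: j \in i :: t by rewrite memT lj sj.
  rewrite inE => /predU1P[->//|jt].
  by move: it; rewrite path_sortedE; [case/andP=> /allP/(_ _ jt)|exact: leq_trans].
move=> _; apply: DeltaSelectNone => i li; apply/negP => si.
by have := memT i; rewrite li si in_nil.
Qed.

Lemma delta_select_fst x l a k (s := delta_select x l a k) :
  map fst s = iota a (size s).
Proof.
rewrite {}/s; elim: k l a => // k IHk l a.
by case: delta_selectP => //= i _ _ _; rewrite IHk.
Qed.

Lemma delta_select_size x l a k : size (delta_select x l a k) <= k.
Proof. by elim: k l a => // k IHk l a; case: delta_selectP => //= *; apply: IHk. Qed.

Lemma delta_select_ge x l a k : {in delta_select x l a k, forall q, l <= q.2}.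
Proof.
elim: k l a => // k IHk l a q; case: delta_selectP => // i li _ _.
by rewrite inE => /predU1P[->//|/IHk]; apply: leq_trans.
Qed.

Lemma delta_select_singular x l a k :
  {in delta_select x l a k, forall q, singular x q.1 q.2}.
Proof.
elim: k l a => // k IHk l a q; case: delta_selectP => // i _ si _.
by rewrite inE => /predU1P[->//|/IHk].
Qed.

Lemma delta_select_color x l a k :
  {in delta_select x l a k, forall q, a <= q.1 < a + k}.
Proof.
move=> q qs; have: q.1 \in map fst (delta_select x l a k) by apply: map_f.
rewrite delta_select_fst mem_iota => /andP[-> /leq_trans]; apply.
by rewrite leq_add2l delta_select_size.
Qed.

Lemma delta_select_chain x l a k b i (s := delta_select x l a k) :
  a < b -> hit s b i -> hit s b.-1 i.
Proof.
rewrite {}/s; elim: k l a => // k IHk l a ab.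
case: delta_selectP => // j _ _ _.
rewrite /hit /= -!/(hit (delta_select _ _ _ _) _ _) [a == b](ltn_eqF ab) /=.
case: (ltngtP a.+1 b) => [ab1|ab1|<-].
- by move=> /(IHk _ _ ab1) ->; rewrite orbT.
- by move: ab1; rewrite ltnS leqNgt ab.
- move=> /hitP[m /delta_select_ge/= jm mi].
  by rewrite eqxx (leq_trans jm mi).
Qed.

Lemma delta_select_hit x l a k b i (s := delta_select x l a k) :
  a <= b < a + k -> singular x b i ->
  (if b == a then l <= i else hit s b.-1 i) -> hit s b i.
Proof.
rewrite {}/s; elim: k l a => [|k IHk] l a; first by rewrite addn0 ltnNge andbN.
case/andP=> ab bk si; case: delta_selectP => [none|j lj sj mj].
  case: eqP => // ba li; move/negP: (none _ li); rewrite -ba; exact.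
rewrite /hit /= -!/(hit (delta_select _ _ _ _) _ _).
case: (eqVneq b a) => [ba li|ba]; first by rewrite mj // -ba.
have {ba}ab : a < b by rewrite ltn_neqAle eq_sym ba.
rewrite orFb => H; apply: IHk => //.
  by rewrite ab addSnnS.
case: eqP => [ba|ba]; move: H.
  rewrite ba /= eqxx /= => /orP[//|/hitP[m /delta_select_color/= ]].
  by rewrite ltnn.
rewrite [a == _]ltn_eqF //; last by lia.
Qed.

Lemma delta_select_ones x a p k :
  (forall b, a <= b < a + p -> singular x b 1) ->
  delta_select x 1 a (p + k) =
  [seq (b, 1) | b <- iota a p] ++ delta_select x 1 (a + p) k.
Proof.
elim: p a => [|p IHp] a sx; first by rewrite addn0.
rewrite addSn; case: delta_selectP => [none|i i1 si mi].
  by case/negP: (none 1 isT); apply: sx; rewrite leqnn addnS ltnS leq_addr.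
have -> : i = 1.
  apply/eqP; rewrite eqn_leq i1 andbT; apply: mi => //.
  by apply: sx; rewrite leqnn addnS ltnS leq_addr.
rewrite /= IHp ?addSnnS// => b abp; apply: sx; lia.
Qed.

(* The rows of length 1 that [beta] adds in the colours below [q] are the first
   ones that [delta] selects, and it deletes them: [delta \o beta] acts on the
   original rows like [delta] started in colour [q]. *)
Definition unboxed (q : nat) (x : rigged_configuration) :=
  if 1 < q then beta q x else x.

Definition box_selection (n q : nat) (x : rigged_configuration) :=
  delta_select (unboxed q x) 1 q (n.+1 - q).

Record box_removal (n q : nat) (x y : rigged_configuration)
    (sel : seq (nat * nat)) : Prop := BoxRemoval {
  box_fst : map fst sel = iota q (size sel);
  box_size : q + size sel <= n.+1;
  box_pos : all (fun p => 0 < p.2) sel;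
  box_chain : forall a i, q < a -> hit sel a i -> hit sel a.-1 i;
  box_perm : exists2 R,
      perm_eq (rigged x) (R ++ rows_with (row_vacancy x) sel)
    & perm_eq (rigged y) (R ++ rows_with (row_vacancy y) (shrink sel));
  box_vacancy : forall a i, 0 < a -> 0 < i ->
    (row_vacancy y a i = row_vacancy x a i + (a == q.-1)%:Z - (a == q)%:Z
     + 2%:Z * (hit sel a i)%:Z - (hit sel a.-1 i)%:Z - (hit sel a.+1 i)%:Z)%R;
  box_hit : forall a i, q <= a <= n -> 0 < i -> singular x a i ->
    (a == q) || hit sel a.-1 i -> hit sel a i
}.

Section BoxRemoval.

Variables (n q : nat) (x : rigged_configuration) (L : seq (nat * nat)).
Hypotheses (q1 : 0 < q) (qn : q <= n) (multx : mult x = seq_mset ((q, 1) :: L)).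

Let x' := unboxed q x.
Let ones := [seq (a, 1) | a <- iota 1 q.-1].
Let sel := box_selection n q x.
Let L' := if 1 < q then [:: (1, 1), (q.-1, 1) & L] else (q, 1) :: L.

Let ones_pos a i : (a, i) \in ones -> (0 < a < q) && (i == 1).
Proof.
by move=> /mapP[b]; rewrite mem_iota => bq [-> ->]; lia.
Qed.

Let mult_unboxed : mult x' = seq_mset L'.
Proof.
rewrite /x' /unboxed /L'; case: ifP => // _.
rewrite /beta /= multx !mset_cons.
by apply/msetP => z; rewrite !msetE2 !msetnE; lia.
Qed.

Let rigged_unboxed :
  perm_eq (rigged x') (rigged x ++ rows_with (row_vacancy x') ones).
Proof.
rewrite /x' /unboxed; case: ifP => [_|q_le1].
  rewrite /beta rigged_add_singular (perm_trans (perm_msetD _ _))//.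
  by rewrite perm_cat2l perm_eq_seq_mset.
by rewrite /ones; case: (q) q_le1 => [|[]]//=; rewrite cats0.
Qed.

(** The Cartan sum over the added rows of colours 1, ..., q - 1 telescopes and cancels the change
    that [beta] makes in the multiplicity array. *)
Lemma vacancy_unboxed a i : 0 < a -> 0 < i ->
  row_vacancy (unboxed q x) a i = row_vacancy x a i.
Proof.
move=> a0 i0; rewrite -/x'; have xL : perm_eq (mult x) ((q, 1) :: L).
  by rewrite multx perm_eq_seq_mset.
have xL' : perm_eq (mult x') L' by rewrite mult_unboxed perm_eq_seq_mset.
rewrite (row_vacancy_vac _ _ xL' rigged_unboxed).
rewrite (row_vacancy_vac _ _ xL (perm_refl _)) map_cat map_fst_rows_with.
rewrite /vac big_cat /=.
have -> : (\sum_(j <- ones) cartan a j.1 * (minn i j.2)%:Z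
    = (a == 1)%:Z + (a == q.-1)%:Z - (a == q)%:Z)%R.
  rewrite big_map /= -big_distrl /= sum_cartan_iota// prednK// (minn_idPr i0) mulr1//.
rewrite /L'; case: ifP => q2; rewrite !big_cons /= (minn_idPr i0);
  set S := (\sum_(j <- L | _) _)%R; set T := (\sum_(j <- map _ _) _)%R.
  rewrite !(eq_sym _ a).
  by case: (eqVneq a 1); case: (eqVneq a q.-1); case: (eqVneq a q) => *; lia.
have -> : q = 1 by lia.
by case: eqP => *; lia.
Qed.

Let singular_ones a : 0 < a < q -> singular x' a 1.
Proof.
move=> aq; rewrite /singular (perm_mem rigged_unboxed) mem_cat mem_rows_with.
rewrite eqxx andbT; apply/orP; right; apply/mapP; exists a => //.
by rewrite mem_iota; lia.
Qed.

Let selE : delta_select x' 1 1 n = ones ++ sel.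
Proof.
have -> : n = q.-1 + (n.+1 - q) by lia.
by rewrite delta_select_ones ?add1n ?prednK.
Qed.

Let shrinkE : shrink (ones ++ sel) = shrink sel.
Proof.
rewrite /shrink filter_cat map_cat; set s := [seq _ <- _ | _].
have -> : s = [::]; last by [].
apply/eqP; rewrite -(negbK (s == _)) -has_filter; apply/hasP => -[[a i]].
by move=> /ones_pos/andP[_ /eqP->].
Qed.

Let sel_pos : {in sel, forall p, 0 < p.1 /\ 0 < p.2}.
Proof.
move=> p ps; split; last exact: (delta_select_ge ps).
by have /andP[/(leq_trans q1)] := delta_select_color ps.
Qed.

Let sel_uniq : uniq (map fst sel).
Proof. by rewrite delta_select_fst iota_uniq. Qed.

Lemma box_removal_delta : box_removal n q x (delta n x') sel.
Proof.
have V p : p \in ones ++ sel ->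
    row_vacancy x' p.1 p.2 = row_vacancy x p.1 p.2.
  rewrite mem_cat => /orP[|/sel_pos[]]; last exact: vacancy_unboxed.
  by case: p => a i /ones_pos/andP[/andP[a0 _] /eqP ->]; apply: vacancy_unboxed.
have [R xR] : exists R,
    perm_eq (rigged x') (R ++ rows_with (row_vacancy x') (ones ++ sel)).
  apply: uniq_sub_perm_cat => [|[p v]].
    apply: (@map_uniq _ _ fst); rewrite map_fst_rows_with -selE.
    by apply: (@map_uniq _ _ fst); rewrite delta_select_fst iota_uniq.
  rewrite mem_rows_with -selE => /andP[/delta_select_singular ps /eqP /= ->].
  by move: ps; rewrite /singular; case: (p).
(* Both descriptions of [rigged x'] contain the rows added by [beta]; cancelling them leaves a
   decomposition of the original rows. *)
have xRs : perm_eq (rigged x) (R ++ rows_with (row_vacancy x) sel).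
  rewrite -(perm_cat2r (rows_with (row_vacancy x') ones)) -catA.
  rewrite perm_sym -(permPr rigged_unboxed) (permPr xR) perm_cat2l.
  rewrite perm_catC /rows_with map_cat -!/(rows_with _ _) perm_cat2l.
  rewrite (_ : rows_with _ sel = rows_with (row_vacancy x') sel)//.
  by apply: eq_rows_with => p ps; rewrite V// mem_cat ps orbT.
have yE : rigged (delta n x') = seq_mset R `+`
    seq_mset (rows_with (row_vacancy (delta n x')) (shrink sel)).
  rewrite [LHS]rigged_add_singular selE -/(shrink _) shrinkE; congr (_ `+` _); last first.
    by rewrite /delta selE -/(shrink _) shrinkE.
  rewrite -/(rows_with _ _) -[rigged x']seq_mset_id.
  by move/eq_seq_msetP: xR => ->; rewrite seq_mset_cat msetDKBC.
have ys : perm_eq (rigged (delta n x'))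
    (R ++ rows_with (row_vacancy (delta n x')) (shrink sel)).
  by rewrite yE -seq_mset_cat perm_eq_seq_mset.
have ym : perm_eq (mult (delta n x')) (if 1 < q then (q.-1, 1) :: L else L).
  rewrite /= mult_unboxed /L'; case: ifP => q2.
    by rewrite mset_cons msetD1K perm_eq_seq_mset.
  have -> : q = 1 by apply/eqP; rewrite eqn_leq q1 leqNgt q2.
  by rewrite mset_cons msetD1K perm_eq_seq_mset.
have xL : perm_eq (mult x) ((q, 1) :: L) by rewrite multx perm_eq_seq_mset.
have pos : all (fun p => 0 < p.2) sel by apply/allP => p /sel_pos[].
split=> //.
- exact: delta_select_fst.
- have : size sel <= n.+1 - q := delta_select_size _ _ _ _; lia.
- by move=> a i; apply: delta_select_chain.
- by exists R.
- move=> a i a0 i0; rewrite (row_vacancy_vac _ _ ym ys).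
  rewrite (row_vacancy_vac _ _ xL xRs) !map_cat !map_fst_rows_with.
  rewrite !vac_catr vac_shrink// vac_cons (minn_idPr i0) (eq_sym q).
  have -> : vac (if 1 < q then (q.-1, 1) :: L else L) (map fst R) a i
      = ((a == q.-1)%:Z + vac L (map fst R) a i)%R.
    case: ifP => q2; first by rewrite vac_cons (minn_idPr i0) eq_sym mulr1.
    have -> : q = 1 by apply/eqP; rewrite eqn_leq q1 leqNgt q2.
    by rewrite (gtn_eqF a0) add0r.
  by ring.
- move=> a i aq i0 sx H; apply: delta_select_hit.
  + lia.
  + rewrite -/x' /singular vacancy_unboxed//; last by lia.
    by rewrite (perm_mem rigged_unboxed) mem_cat; apply/orP; left.
  + by case: eqP H => // _ _.
Qed.

End BoxRemoval.

(** * Removal of a column *)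

(* [sel j] is the selection made when the letter in row [j] of the leftmost
   column is removed, for [j = r, ..., 1]. The splitting [gamma] behaves like a
   stage [r + 1] whose selection has length [k] in all colours: it makes the
   rows of [nu^(r)] that are shorter than [k] nonsingular. *)
Definition column_hit (r k : nat) (sel : nat -> seq (nat * nat)) (j a i : nat) :=
  if j == r.+1 then k <= i else hit (sel j) a i.

Definition selected (r : nat) (sel : nat -> seq (nat * nat)) (j : nat) :=
  flatten [seq sel p | p <- iota j.+1 (r - j)].

(* [x] is reduced to [z] by removing a column of height [r] from a factor
   [B^{r,k}]. The selected rows, the new riggings and the condition of
   minimality (on the set [U] of the untouched rows) are all expressed through
   the vacancy numbers of [x] and [z], without those of the intermediate
   configurations. *)
Record column_removal (n r k : nat) (x z : rigged_configuration)
    (sel : nat -> seq (nat * nat)) : Prop := ColumnRemoval {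
  column_fst : forall j, 0 < j <= r ->
    map fst (sel j) = iota j (size (sel j));
  column_size : forall j, 0 < j <= r -> j + size (sel j) <= n.+1;
  column_pos : forall j, 0 < j <= r -> all (fun p => 0 < p.2) (sel j);
  column_chain : forall j a i, 0 < j <= r -> j < a ->
    hit (sel j) a i -> hit (sel j) a.-1 i;
  column_nest : forall j a i, 0 < j <= r ->
    hit (sel j) a i -> column_hit r k sel j.+1 a.+1 i;
  column_perm : exists U, [/\
    perm_eq (rigged x) (U ++ rows_with (row_vacancy x) (selected r sel 0)),
    perm_eq (rigged z)
      (U ++ rows_with (row_vacancy z) (shrink (selected r sel 0)))
    & forall a i j, ((a, i), row_vacancy x a i) \in U -> 0 < j <= r -> j <= a ->
      column_hit r k sel j.+1 a.+1 i -> (a == j) || hit (sel j) a.-1 i ->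
      hit (sel j) a i]
}.

Lemma column_hit_le r k sel j a i i' : i <= i' ->
  column_hit r k sel j a i -> column_hit r k sel j a i'.
Proof.
rewrite /column_hit => ii'; case: eqP => _; last exact: hit_le.
by move/leq_trans; apply.
Qed.

Lemma mem_fst_iota (s : seq (nat * nat)) j a l :
  map fst s = iota j (size s) -> (a, l) \in s -> j <= a < j + size s.
Proof. by move=> sj al; rewrite -mem_iota -sj; apply: (map_f fst al). Qed.

Lemma hit_fst_iota (s : seq (nat * nat)) j a i :
  map fst s = iota j (size s) -> hit s a i -> j <= a < j + size s.
Proof. by move=> sj /hitP[l /(mem_fst_iota sj)]. Qed.

Lemma hit_uniq (s : seq (nat * nat)) j a l i :
  map fst s = iota j (size s) -> (a, l) \in s -> hit s a i = (l <= i).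
Proof.
move=> sj al; apply/hitP/idP => [[l' al' l'i]|li]; last by exists l.
suff -> : l = l' by [].
have us : uniq (map fst s) by rewrite sj iota_uniq.
elim: s us al al' {sj} => //= -[b m] s IHs /= /andP[bs us].
rewrite !inE => /predU1P[[? ?]|al] /predU1P[[? ?]|al']; subst => //.
- by move/negP: bs; case; apply: (map_f fst al').
- by move/negP: bs; case; apply: (map_f fst al).
- exact: IHs.
Qed.

Lemma mem_shrink (s : seq (nat * nat)) a l :
  ((a, l) \in shrink s) = (0 < l) && ((a, l.+1) \in s).
Proof.
apply/mapP/andP => [[[b m]]|[l0 al]].
  rewrite mem_filter /= => /andP[m1 bm] [-> ->]; rewrite prednK; first by lia.
  by lia.
by exists (a, l.+1); rewrite // mem_filter /= ltnS l0.
Qed.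

Lemma shrink_cat s t : shrink (s ++ t) = shrink s ++ shrink t.
Proof. by rewrite /shrink filter_cat map_cat. Qed.

Lemma rows_with_cat f s t :
  rows_with f (s ++ t) = rows_with f s ++ rows_with f t.
Proof. exact: map_cat. Qed.

Lemma selected_pred r sel j : 0 < j <= r ->
  selected r sel j.-1 = sel j ++ selected r sel j.
Proof.
case: j => // j /= jr; rewrite /selected.
by have -> : r - j = (r - j.+1).+1 by lia.
Qed.

Lemma mem_selected r sel j q :
  reflect (exists2 p, j < p <= r & q \in sel p) (q \in selected r sel j).
Proof.
apply: (iffP flatten_mapP) => -[p]; rewrite ?mem_iota => pj qp; exists p => //.
  by lia.
by rewrite mem_iota; lia.
Qed.

Section ColumnRemoval.

Variables (n r k : nat) (x : rigged_configuration) (L : row_mset).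
Variables (y : nat -> rigged_configuration) (sel : nat -> seq (nat * nat)).
Hypothesis xRC : RC n L x.
Hypothesis rigged_top : rigged (y r) = rigged x.
Hypothesis vacancy_top : forall a i, 0 < a -> 0 < i ->
  (row_vacancy (y r) a i = row_vacancy x a i + ((a == r) && (i < k)%N)%:Z)%R.
Hypothesis box : forall j, 0 < j <= r -> box_removal n j (y j) (y j.-1) (sel j).

Let H := column_hit r k sel.

(* The stages [r, ..., j + 1] change a vacancy number in the range where stage
   [j] searches by at most 1: it is larger by 1 exactly at the lengths not hit
   in the next colour by the previous stage. *)
Record column_invariant (j : nat) : Prop := ColumnInvariant {
  inv_nest : forall p a i, j < p <= r -> hit (sel p) a i -> H p.+1 a.+1 i;
  inv_perm : exists U, [/\
    perm_eq (rigged x) (U ++ rows_with (row_vacancy x) (selected r sel j)),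
    perm_eq (rigged (y j))
      (U ++ rows_with (row_vacancy (y j)) (shrink (selected r sel j)))
    & forall a i p, ((a, i), row_vacancy x a i) \in U -> j < p <= r -> p <= a ->
      H p.+1 a.+1 i -> (a == p) || hit (sel p) a.-1 i ->
      hit (sel p) a i];
  inv_vacancy : forall a i, 0 < a -> 0 < i -> j <= a -> (a == j) || H j.+1 a i ->
    (row_vacancy (y j) a i = row_vacancy x a i + 1 - (H j.+1 a.+1 i)%:Z)%R;
  inv_vacancy_lt : forall a i, 0 < a -> 0 < i -> a < j ->
    row_vacancy (y j) a i = row_vacancy x a i
}.

(** Nesting raises stage and colour by one, and the chain condition brings the colour back down; so
    the stage climbs while the colour stays fixed. *)
Let climb j p a i : 0 < j <= p -> p <= r -> p <= a ->
  (forall p' a' i', j <= p' < p -> hit (sel p') a' i' -> H p'.+1 a'.+1 i') ->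
  hit (sel j) a i -> hit (sel p) a i.
Proof.
elim: p => [|p IHp] /andP[j0 jp] pr pa nest hj; first by lia.
have [<-//|jp'] : j = p.+1 \/ j <= p by lia.
have {}hj : hit (sel p) a i.
  by apply: IHp => //; [lia|lia|lia|move=> p' a' i' ?; apply: nest; lia].
have := nest p a i; rewrite /H /column_hit eqSS ltn_eqF// => N.
have pp : 0 < p.+1 <= r by lia.
by apply: (box_chain (box pp) (a := a.+1)); [|apply: N; lia].
Qed.

Lemma column_invariant_top : column_invariant r.
Proof.
split.
- by move=> p a i; lia.
- exists (rigged x); rewrite /selected subnn /= !cats0 rigged_top; split=> //.
  by move=> a i p _; lia.
- move=> a i a0 i0 ra; rewrite vacancy_top// /H /column_hit eqxx.
  by case: (eqVneq a r) => /=; case: (leqP k i) => //= *; lia.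
- by move=> a i a0 i0 ar; rewrite vacancy_top// (ltn_eqF ar) addr0.
Qed.

(** The crucial point is the nesting of stage j in stage j + 1. Where it fails, the vacancy number
    exceeds that of [x] by 1, so a selected untouched row would have an inadmissible rigging in [x];
    and a row shortened before is too short to be selected. *)
Lemma column_invariant_pred j :
  0 < j <= r -> column_invariant j -> column_invariant j.-1.
Proof.
move=> j0r [nest [U [xU yU hitU]] vacj vaclt].
have [/andP[j0 jr] B] := (j0r, box j0r).
have sj := box_fst B.
have selj p a l : j < p <= r -> (a, l) \in sel p -> p <= a.
  move=> jp al; have pp : 0 < p <= r by lia.
  by have := mem_fst_iota (box_fst (box pp)) al; lia.
have Hsel : j < r -> H j.+1 = hit (sel j.+1).
  by move=> jr'; rewrite /H /column_hit eqSS ltn_eqF.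
(* A row shortened at stage p now has length l, whereas by climbing any hit of stage j + 1 in its
   colour needs length at least l + 1. *)
have nosel a l p i : j < p <= r -> (a, l.+1) \in sel p -> i <= l ->
    H j.+1 a i = false.
  move=> jp al il; have pp : 0 < p <= r by lia.
  rewrite Hsel; last by lia.
  apply/negP => h; have : hit (sel p) a i.
    apply: climb h => //; [lia|lia|exact: selj al|].
    by move=> p' a' i' ?; apply: nest; lia.
  by rewrite (hit_uniq _ (box_fst (box pp)) al); lia.
have nestj a i : hit (sel j) a i -> H j.+1 a.+1 i.
  suff E l : (a, l) \in sel j -> H j.+1 a.+1 l.
    by move=> /hitP[l /E hl li]; apply: column_hit_le hl.
  move: l; have [m] := ubnP a; elim: m a => // m IHm a am l al.
  have ja : j <= a by have := mem_fst_iota sj al; lia.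
  have l0 : 0 < l by have /allP/(_ _ al) := box_pos B.
  have pre : (a == j) || H j.+1 a l.
    have [->|aj] := eqVneq a j; first by [].
    have : hit (sel j) a.-1 l.
      by apply: (box_chain B); [lia|apply/hitP; exists l].
    move=> /hitP[l' al' l'l]; have := IHm a.-1 _ l' al'.
    by rewrite prednK; [move=> /(_ _)/(column_hit_le l'l); apply; lia|lia].
  have a0 : 0 < a by lia.
  have V := vacj a l a0 l0 ja pre.
  have := box_perm B => -[R yR _].
  have : ((a, l), row_vacancy (y j) a l) \in rigged (y j).
    by rewrite (perm_mem yR) mem_cat mem_rows_with /= al eqxx orbT.
  rewrite (perm_mem yU) mem_cat => /orP[inU|].
    (* If the next colour were not hit, this untouched row would have rigging one more than its
       vacancy number in [x]. *)
    have /(_ _) := (let: And4 _ _ _ h := xRC in h) ((a, l), row_vacancy (y j) a l).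
    rewrite (perm_mem xU) mem_cat inU => /(_ isT)/= /andP[_].
    by rewrite V; case: (H _ _ _) => //; lia.
  rewrite mem_rows_with mem_shrink /= => /andP[/andP[_ /mem_selected[p jp alp]] _].
  have pa := selj _ _ _ jp alp; have := nosel _ _ _ _ jp alp (leqnn l).
  move: pre; case: eqP => /= [aj|_ ->//]; lia.
have nestp p a i : j.-1 < p <= r -> hit (sel p) a i -> H p.+1 a.+1 i.
  move=> jp; have [->|pj] := eqVneq p j; first exact: nestj.
  by apply: nest; lia.
have preE a i : 0 < a -> 0 < i -> j <= a -> (a == j) || hit (sel j) a.-1 i ->
    (row_vacancy (y j) a i = row_vacancy x a i + 1 - (H j.+1 a.+1 i)%:Z)%R.
  move=> a0 i0 ja pre; apply: vacj => //; case/orP: pre => [->//|/nestj].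
  by rewrite prednK// => ->; rewrite orbT.
have hitE a i : 0 < i -> hit (sel j) a i ->
    row_vacancy (y j) a i = row_vacancy x a i.
  move=> i0 h; have ja := hit_fst_iota sj h.
  rewrite preE//; [|lia|lia|].
    by rewrite (nestj _ _ h) addrK.
  by have [//|aj] := eqVneq a j; apply: (box_chain B) h; lia.
have := box_perm B => -[R yR zR].
have yRU : perm_eq (R ++ rows_with (row_vacancy (y j)) (sel j))
    (U ++ rows_with (row_vacancy (y j)) (shrink (selected r sel j))).
  by rewrite -(permPl yR).
(* Stage j selects none of the rows shortened before, so its rows all come from [U]; [e] is what it
   leaves of [U]. *)
have [q|e Ue Re] := perm_cat_disjoint yRU.
  rewrite !mem_rows_with => /andP[qs _]; apply: contraTN isT => /andP[+ _].
  case: q qs => -[a l] v /= al; rewrite mem_shrink => /andP[_].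
  move=> /mem_selected[p jp alp]; have pa := selj _ _ _ jp alp.
  have hj : hit (sel j) a.-1 l.
    by apply: (box_chain B); [lia|apply/hitP; exists l].
  by have := nosel _ _ _ _ jp alp (leqnn l); rewrite -[a]prednK ?nestj//; lia.
have nohit a l p : j < p <= r -> (a, l.+1) \in sel p -> [/\
    hit (sel j) a l = false, hit (sel j) a.-1 l = false
    & hit (sel j) a.+1 l = false].
  move=> jp al; have pa := selj _ _ _ jp al.
  have h1 : hit (sel j) a.-1 l = false.
    apply/negP => /nestj; rewrite prednK; last by lia.
    by rewrite (nosel _ _ _ _ jp al).
  have h0 : hit (sel j) a l = false.
    have ja : j < a by clear -jp pa; lia.
    by apply/negP => /(box_chain B ja); rewrite h1.
  split=> //; have ja : j < a.+1 by clear -jp pa; lia.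
  by apply/negP => /(box_chain B ja); rewrite h0.
split.
- exact: nestp.
- exists e; rewrite !selected_pred//; split.
  + have rE : rows_with (row_vacancy (y j)) (sel j) =
        rows_with (row_vacancy x) (sel j).
      apply: eq_rows_with => -[a l] al; apply: hitE => /=.
        by have /allP/(_ _ al) := box_pos B.
      by apply/hitP; exists l.
    apply/permP => p; rewrite (permP xU) rows_with_cat !count_cat (permP Ue).
    by rewrite count_cat rE addnA.
  (* Stage j hits neither the colour of an already shortened row nor the two adjacent ones at its
     length, so the row stays singular with an unchanged rigging. *)
  + have rE : rows_with (row_vacancy (y j)) (shrink (selected r sel j)) =
        rows_with (row_vacancy (y j.-1)) (shrink (selected r sel j)).
      apply: eq_rows_with => -[a l]; rewrite mem_shrink => /andP[l0].
      move=> /mem_selected[p jp alp] /=; have pa := selj _ _ _ jp alp.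
      have [h0 h1 h2] := nohit _ _ _ jp alp.
      have [a0 aj aj1] : [/\ 0 < a, j < a & j.-1 < a] by clear -jp pa; split; lia.
      by rewrite (box_vacancy B)// h0 h1 h2 !gtn_eqF//; clear; lia.
    apply/permP => p; rewrite (permP zR) shrink_cat rows_with_cat !count_cat.
    by rewrite (permP Re) count_cat -rE -addnA [X in _ + X]addnC.
  + move=> a i p ae jp pa.
    have aU : ((a, i), row_vacancy x a i) \in U by rewrite (perm_mem Ue) mem_cat ae.
    have [pj|pj] := eqVneq p j; last first.
      by apply: hitU => //; clear -jp pj; lia.
    subst p => h pre; have /(_ _)/= := (let: And4 _ b _ _ := xRC in b) ((a, i), row_vacancy x a i).
    rewrite (perm_mem xU) mem_cat aU => /(_ isT)/andP[/andP[a0 an] i0].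
    apply: (box_hit B) => //; first by rewrite pa.
    (* Where the previous stage hits the next colour, the vacancy number is again that of [x]; a row
       singular in [x] is therefore available to stage j, whose minimality applies. *)
    rewrite /singular preE// h addrK.
    by rewrite (perm_mem yU) mem_cat aU.
- move=> a i a0 i0 ja; rewrite prednK// => pre.
  have Hj : H j =1 hit (sel j) by move=> b; rewrite /H /column_hit ltn_eqF.
  rewrite !Hj in pre *; rewrite (box_vacancy B)//.
  case/orP: pre => [/eqP aj|h].
    rewrite aj in a0 *; rewrite vaclt//; last by lia.
    have nh b : b < j -> hit (sel j) b i = false.
      by move=> bj; apply/negP => /(hit_fst_iota sj); lia.
    have [jj j2 j1] : [/\ j.-1 != j, j.-2 < j & j.-1 < j] by clear -j0; split; lia.
    by rewrite eqxx prednK// (negPf jj) (nh _ j1) (nh _ j2); clear; lia.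
  have ja' := hit_fst_iota sj h; rewrite hitE// h.
  have aj1 : a == j.-1 = false by apply/eqP; clear -ja' j0; lia.
  rewrite aj1; have [aj|aj] := eqVneq a j.
    have -> : hit (sel j) a.-1 i = false.
      by apply/negP => /(hit_fst_iota sj); clear -aj j0; lia.
    by clear; lia.
  have aj' : j < a by clear -aj ja'; lia.
  by rewrite (box_chain B aj' h); clear; lia.
- move=> a i a0 i0 aj; have [ja nj1 nj] : [/\ a < j, a != j.-1 & a != j].
    by clear -aj; split; lia.
  rewrite (box_vacancy B)// vaclt// (negPf nj) (negPf nj1).
  have nh b : b < j -> hit (sel j) b i = false.
    by move=> bj; apply/negP => /(hit_fst_iota sj); rewrite leqNgt bj.
  by rewrite !nh; clear -aj; lia.
Qed.

Lemma column_invariant_all j : j <= r -> column_invariant j.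
Proof.
move=> jr; have [d ->] : exists d, j = r - d by exists (r - j); lia.
elim: d => [|d IHd]; first by rewrite subn0; apply: column_invariant_top.
have [->|rd] := eqVneq (r - d.+1) (r - d); first exact: IHd.
have -> : r - d.+1 = (r - d).-1 by lia.
by apply: column_invariant_pred IHd; lia.
Qed.

Lemma column_removal_boxes : column_removal n r k x (y 0) sel.
Proof.
have [nest perm _ _] := column_invariant_all (leq0n r).
split=> //; first by move=> j /box/box_fst.
- by move=> j /box/box_size.
- by move=> j /box/box_pos.
- by move=> j a i /box/box_chain; apply.
Qed.

End ColumnRemoval.

(** * A column removal is determined by its characterization *)

Lemma hit_inj (s t : seq (nat * nat)) j :
  map fst s = iota j (size s) -> map fst t = iota j (size t) ->
  hit s =2 hit t -> s = t.
Proof.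
elim: s t j => [|[a l] s IHs] [|[b m] t] j //= .
- by move=> _ [-> _] /(_ j m); rewrite /hit /= eqxx leqnn.
- by move=> [-> _] _ /(_ j l); rewrite /hit /= eqxx leqnn.
move=> sj tj st; case: (sj) (tj) => [? s1] [? t1]; subst a b.
have st_le i : (l <= i) = (m <= i).
  have := st j i; rewrite (@hit_uniq ((j, l) :: s) j j l) ?mem_head//.
  by rewrite (@hit_uniq ((j, m) :: t) j j m) ?mem_head.
have -> : l = m by apply/eqP; rewrite eqn_leq st_le leqnn -st_le leqnn.
congr cons; apply: (IHs _ _ s1 t1) => a i.
have := st a i; rewrite /hit /= -!/(hit _ _ _).
have [ja|//] := eqVneq j a; move=> _.
transitivity false; last apply/esym; apply/negP.
  by move=> /(hit_fst_iota s1); rewrite ja ltnn.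
by move=> /(hit_fst_iota t1); rewrite ja ltnn.
Qed.

Lemma selected_cat r sel j : j <= r ->
  selected r sel 0 = selected j sel 0 ++ selected r sel j.
Proof.
move=> jr; rewrite /selected !subn0 -flatten_cat -map_cat -[in iota j.+1 _]add1n.
by rewrite -iotaD subnKC.
Qed.

Lemma column_climb n r k x z sel p j a i :
  column_removal n r k x z sel -> 0 < p <= j -> j <= r -> j <= a ->
  hit (sel p) a i -> hit (sel j) a i.
Proof.
move=> C; elim: j => [|j IHj] pj jr ja h; first by lia.
have [<-//|pj'] : p = j.+1 \/ p <= j by lia.
have {}h : hit (sel j) a i by apply: IHj => //; clear -pj pj' jr ja; lia.
have j0 : 0 < j <= r by clear -pj pj' jr; lia.
have := column_nest C j0 h; rewrite /column_hit eqSS ltn_eqF//.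
by apply: (column_chain C (a := a.+1)) => //; clear -jr ja; lia.
Qed.

(** A row selected by [sel j] is singular in [x]. In the second decomposition it is either
    untouched, and then minimality of [sel'] produces a hit, or selected at some stage p <= j, and
    then the hit climbs to stage j. The induction on the colour supplies the hit in the preceding
    colour. *)
Lemma column_selection_sub n r k x z z' sel sel' j :
  column_removal n r k x z sel -> column_removal n r k x z' sel' ->
  0 < j <= r -> (forall p, j < p <= r -> sel p = sel' p) ->
  forall a i, hit (sel j) a i -> hit (sel' j) a i.
Proof.
move=> C C' jr eqs.
suff E a l : (a, l) \in sel j -> hit (sel' j) a l.
  by move=> a i /hitP[l al li]; apply: hit_le li (E a l al).
have eqS : selected r sel j = selected r sel' j.
  congr flatten; apply/eq_in_map => p; rewrite mem_iota => pj; apply: eqs.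
  by clear -pj; lia.
have [U [xU _ _]] := column_perm C; have [U' [xU' _ hitU']] := column_perm C'.
have UU : perm_eq (U ++ rows_with (row_vacancy x) (selected j sel 0))
    (U' ++ rows_with (row_vacancy x) (selected j sel' 0)).
  have /andP[_ jr'] := jr.
  rewrite -(perm_cat2r (rows_with (row_vacancy x) (selected r sel j))) -!catA.
  rewrite [in X in perm_eq _ X]eqS -!rows_with_cat -!selected_cat//.
  by rewrite -(permPl xU).
move: l; have [b] := ubnP a; elim: b a => // b IHb a ab l al.
have ja : j <= a by have := mem_fst_iota (column_fst C jr) al; case/andP.
have hal : hit (sel j) a l by apply/hitP; exists l.
have : ((a, l), row_vacancy x a l) \in
    U ++ rows_with (row_vacancy x) (selected j sel 0).
  rewrite mem_cat mem_rows_with /= eqxx andbT; apply/orP; right.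
  by apply/mem_selected; exists j; rewrite ?leqnn ?andbT//; case/andP: jr.
rewrite (perm_mem UU) mem_cat => /orP[inU'|].
  apply: (hitU' _ _ _ inU') => //.
    have := column_nest C jr hal; rewrite /column_hit.
    by case: eqP => // /eqP jr1; rewrite eqs//; clear -jr jr1; lia.
  have [//|aj] := eqVneq a j.
  have ja' : j < a by clear -ja aj; lia.
  have /hitP[l' al' l'l] := column_chain C jr ja' hal.
  by apply: hit_le l'l _; apply: IHb => //; clear -ab ja'; lia.
rewrite mem_rows_with /= => /andP[/mem_selected[p pj alp] _].
by apply: (column_climb C' pj _ ja); [case/andP: jr|apply/hitP; exists l].
Qed.

Lemma column_selection_eq n r k x z z' sel sel' :
  column_removal n r k x z sel -> column_removal n r k x z' sel' ->
  forall j, 0 < j <= r -> sel j = sel' j.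
Proof.
move=> C C' j; have [d] := ubnP (r - j); elim: d j => // d IHd j rd jr.
have eqs p : j < p <= r -> sel p = sel' p.
  by move=> jp; apply: IHd; clear -rd jr jp; lia.
apply: (hit_inj (column_fst C jr) (column_fst C' jr)) => a i.
apply/idP/idP; first exact: (column_selection_sub C C' jr eqs).
by apply: (column_selection_sub C' C jr) => p /eqs.
Qed.

(** Equal selections give [z] and [z'] the same row lengths, which together with the multiplicity
    array fix the vacancy numbers; these are the riggings of the shortened rows. *)
Lemma column_removal_uniq n r k x z z' sel sel' :
  column_removal n r k x z sel -> column_removal n r k x z' sel' ->
  mult z = mult z' -> z = z'.
Proof.
move=> C C' zz'; have eqs := column_selection_eq C C'.
have [U [xU zU _]] := column_perm C; have [U' [xU' zU' _]] := column_perm C'.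
have eqS : selected r sel' 0 = selected r sel 0.
  by congr flatten; apply/eq_in_map => p; rewrite mem_iota => pj; rewrite eqs//; lia.
rewrite eqS in xU' zU'; have UU' : perm_eq U U'.
  by rewrite -(perm_cat2r (rows_with (row_vacancy x) (selected r sel 0))) -(permPl xU).
have V a i : row_vacancy z a i = row_vacancy z' a i.
  rewrite (row_vacancy_vac _ _ (perm_refl _) zU).
  rewrite (row_vacancy_vac _ _ (perm_refl _) zU') zz' !map_cat !map_fst_rows_with.
  by apply: vac_perm => //; rewrite perm_cat2r perm_map.
apply: rigged_configuration_eq => //; rewrite -[LHS]seq_mset_id -[RHS]seq_mset_id.
apply/eq_seq_msetP; rewrite (permPl zU) (permPr zU').
rewrite (_ : rows_with (row_vacancy z) _ = rows_with (row_vacancy z')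
  (shrink (selected r sel 0))) ?perm_cat2r//.
by apply: eq_rows_with => q _; apply: V.
Qed.

(** * Scaling *)

(** A row may reach length 0 during the interpolation. It contributes nothing to a vacancy number,
    so it can be kept in the computation and dropped from the configuration. *)
Definition nonempty_rows (s : seq (nat * nat)) := [seq q <- s | 0 < q.2].

Lemma vac_nonempty_rowsl l s a i : vac (nonempty_rows l) s a i = vac l s a i.
Proof.
rewrite /vac /nonempty_rows big_filter_cond; congr (_ - _)%R.
rewrite [RHS](bigID (fun q => 0 < q.2)) /= [X in (_ + X)%R]big1.
  by rewrite addr0; apply: eq_bigl => q; rewrite andbC.
by move=> q /andP[_]; rewrite lt0n negbK => /eqP ->; rewrite minn0.
Qed.

Lemma vac_nonempty_rowsr l s a i : vac l (nonempty_rows s) a i = vac l s a i.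
Proof.
rewrite /vac /nonempty_rows big_filter; congr (_ - _)%R.
rewrite [RHS](bigID (fun q => 0 < q.2)) /= [X in (_ + X)%R]big1 ?addr0//.
by move=> q; rewrite lt0n negbK => /eqP ->; rewrite minn0 mulr0.
Qed.

Lemma shrink_nonempty_rows s : shrink s = nonempty_rows [seq (q.1, q.2.-1) | q <- s].
Proof.
rewrite /shrink /nonempty_rows filter_map; congr map; apply: eq_filter => -[a l] /=.
by case: l => [|[]].
Qed.

(** Two lengths that each drop by at most 1 never exchange their order strictly, so one of them is
    the minimum at both ends. *)
Lemma minn_interpolation (u v i i' l l' : nat) :
  i' <= i <= i'.+1 -> l' <= l <= l'.+1 ->
  minn (u * i + v * i') (u * l + v * l') = u * minn i l + v * minn i' l'.
Proof.
move=> hi hl; have [[il il']|[li li']] : i <= l /\ i' <= l' \/ l <= i /\ l' <= i'.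
- by lia.
- by rewrite !(minn_idPl _) // leq_add// leq_mul2l ?il ?il' orbT.
- by rewrite !(minn_idPr _) // leq_add// leq_mul2l ?li ?li' orbT.
Qed.

(* A quadruple [(a, (l, l'))] is a row of colour [a] moving linearly from
   length [l] to length [l']. *)
Definition interpolate (u v : nat) (q : nat * (nat * nat)) :=
  (q.1, u * q.2.1 + v * q.2.2).

Definition slow (q : nat * (nat * nat)) := q.2.2 <= q.2.1 <= q.2.2.+1.

Lemma vac_interpolation u v l s a i i' :
  all slow l -> all slow s -> i' <= i <= i'.+1 ->
  (vac (map (interpolate u v) l) (map (interpolate u v) s) a (u * i + v * i')
   = u%:Z * vac [seq (q.1, q.2.1) | q <- l] [seq (q.1, q.2.1) | q <- s] a i
     + v%:Z * vac [seq (q.1, q.2.2) | q <- l] [seq (q.1, q.2.2) | q <- s] a i')%R.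
Proof.
move=> /allP sl /allP ss ii'; rewrite /vac !big_map /= !mulrBr !mulr_sumr.
rewrite addrACA -opprD -!big_split /=; congr (_ - _)%R.
  rewrite big_seq_cond [RHS]big_seq_cond; apply: eq_bigr => q /andP[/sl sq _].
  by rewrite minn_interpolation// PoszD !PoszM.
rewrite big_seq [RHS]big_seq; apply: eq_bigr => q /ss sq.
by rewrite minn_interpolation// PoszD !PoszM; ring.
Qed.

Definition scale_row (m : nat) (q : nat * nat) := (q.1, m * q.2).

Definition scale_rigged (m : nat) (y : (nat * nat) * int) :=
  (scale_row m y.1, (y.2 *+ m)%R).

(** The substitution of (i + t) %/ m for i translates every condition on step t of the scaled
    removal into the same condition on the original one. *)
Lemma hit_scaled m t s a i : 0 < m ->
  hit [seq (q.1, m * q.2 - t) | q <- s] a i = hit s a ((i + t) %/ m).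
Proof.
move=> m0; rewrite /hit has_map; apply: eq_has => -[b l] /=.
by rewrite leq_subLR leq_divRL// mulnC addnC.
Qed.

Section Scaling.

Variables (n r k m : nat) (x z : rigged_configuration).
Variables (Lx Lz : row_mset) (L : seq (nat * nat)) (sel : nat -> seq (nat * nat)).
Hypotheses (m0 : 0 < m) (k0 : 0 < k).
Hypotheses (xRC : RC n Lx x) (zRC : RC n Lz z) (C : column_removal n r k x z sel).
Hypothesis multx : perm_eq (mult x) ((r, k) :: L).
Hypothesis multz : perm_eq (mult z) (nonempty_rows ((r, k.-1) :: L)).
Hypothesis Lpos : all (fun q => 0 < q.2) L.

Let S := selected r sel 0.

Variable U : seq ((nat * nat) * int).
Hypothesis xU : perm_eq (rigged x) (U ++ rows_with (row_vacancy x) S).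
Hypothesis zU : perm_eq (rigged z) (U ++ rows_with (row_vacancy z) (shrink S)).
Hypothesis hitU : forall a i j, ((a, i), row_vacancy x a i) \in U ->
  0 < j <= r -> j <= a ->
  column_hit r k sel j.+1 a.+1 i -> (a == j) || hit (sel j) a.-1 i ->
  hit (sel j) a i.

Let Lt t := nonempty_rows ((r, m * k - t) :: map (scale_row m) L).
Let St t := [seq (q.1, m * q.2 - t) | q <- S].
Let sel_t t j := [seq (q.1, m * q.2 - t) | q <- sel j].

(* The configuration after [t] of the [m] copies of the column are removed from
   [sim_RC m x]. All row lengths, hence all vacancy numbers at corresponding
   lengths, interpolate linearly between [sim_RC m x] and [sim_RC m z]. *)
Let X t := add_singular (seq_mset (Lt t)) (seq_mset (map (scale_rigged m) U))
  (nonempty_rows (St t)).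

Let Spos : all (fun q => 0 < q.2) S.
Proof.
by apply/allP => q /mem_selected[p pr]; have /allP := column_pos C pr; apply.
Qed.

Let XU t : perm_eq (rigged (X t))
  (map (scale_rigged m) U ++ rows_with (row_vacancy (X t)) (nonempty_rows (St t))).
Proof. by rewrite rigged_add_singular -seq_mset_cat perm_eq_seq_mset. Qed.

Let vacX t a i i' : t <= m -> i' <= i <= i'.+1 ->
  (row_vacancy (X t) a ((m - t) * i + t * i') =
     (m - t)%:Z * row_vacancy x a i + t%:Z * row_vacancy z a i')%R.
Proof.
move=> tm ii'; have XL : perm_eq (mult (X t)) (Lt t) := perm_eq_seq_mset _.
rewrite (row_vacancy_vac _ _ XL (XU t)).
rewrite (row_vacancy_vac _ _ multx xU) (row_vacancy_vac _ _ multz zU).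
rewrite !map_cat !map_fst_rows_with !(vac_nonempty_rowsl, vac_catr, vac_nonempty_rowsr).
rewrite shrink_nonempty_rows vac_nonempty_rowsr -!vac_catr.
pose l := (r, (k, k.-1)) :: [seq (q.1, (q.2, q.2)) | q <- L].
pose s := [seq (y.1.1, (y.1.2, y.1.2)) | y <- U]
  ++ [seq (q.1, (q.2, q.2.-1)) | q <- S].
have sl : all slow l.
  by rewrite /l /= all_map /slow /= leq_pred leqSpred /=; apply/allP => q _ /=; lia.
have ss : all slow s.
  rewrite all_cat !all_map /slow; apply/andP; split; apply/allP => q _ /=; lia.
have arith p : 0 < p -> (m - t) * p + t * p.-1 = m * p - t.
  by case: p => // p _; rewrite /= mulnBl !mulnS; have := leq_mul2r p t m; nia.
have arith' p : (m - t) * p + t * p = m * p by rewrite -mulnDl subnK.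
have lt : map (interpolate (m - t) t) l = (r, m * k - t) :: map (scale_row m) L.
  rewrite /l /= /interpolate /= arith// -map_comp; congr cons.
  by apply: eq_map => q /=; rewrite arith'.
have st : map (interpolate (m - t) t) s =
    map fst (map (scale_rigged m) U) ++ St t.
  rewrite /s map_cat -!map_comp; congr (_ ++ _).
    by apply: eq_map => q /=; rewrite /interpolate /= arith'.
  apply/eq_in_map => q qS; rewrite /interpolate /= arith//.
  by have /allP/(_ _ qS) := Spos.
have l1 : [seq (q.1, q.2.1) | q <- l] = (r, k) :: L.
  by rewrite /l /= -map_comp map_id_in// => -[].
have l2 : [seq (q.1, q.2.2) | q <- l] = (r, k.-1) :: L.
  by rewrite /l /= -map_comp map_id_in// => -[].
have s1 : [seq (q.1, q.2.1) | q <- s] = map fst U ++ S.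
  rewrite /s map_cat -!map_comp; congr (_ ++ _); last by rewrite map_id_in => // -[].
  by apply: eq_map => -[[]].
have s2 : [seq (q.1, q.2.2) | q <- s] = map fst U ++ [seq (q.1, q.2.-1) | q <- S].
  by rewrite /s map_cat -!map_comp; congr (_ ++ _); apply: eq_map => -[[]].
have := vac_interpolation (m - t) t a sl ss ii'.
by rewrite lt st l1 l2 s1 s2.
Qed.

Lemma column_removal_scaled t : t < m ->
  column_removal n r (m * k - t) (X t) (X t.+1) (sel_t t).
Proof.
move=> tm; have hs p : hit (sel_t t p) =2 fun a i => hit (sel p) a ((i + t) %/ m).
  by move=> a i; apply: hit_scaled.
have chs p a i :
    column_hit r (m * k - t) (sel_t t) p a i = column_hit r k sel p a ((i + t) %/ m).
  rewrite /column_hit hs; case: eqP => // _.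
  by rewrite leq_subLR leq_divRL// mulnC addnC.
have fstE p : map fst (sel_t t p) = map fst (sel p).
  by rewrite -map_comp; apply: eq_map.
have selS : selected r (sel_t t) 0 = St t.
  by rewrite /St /S /selected map_flatten -map_comp.
have posE l : 0 < l -> 0 < m * l - t.
  by move=> l0; rewrite subn_gt0 (leq_trans tm)// leq_pmulr.
split.
- by move=> p pr; rewrite fstE size_map (column_fst C).
- by move=> p pr; rewrite size_map (column_size C).
- move=> p /(column_pos C)/allP h; apply/allP => _ /mapP[q /h q0 ->] /=.
  exact: posE.
- by move=> p a i; rewrite !hs; apply: (column_chain C).
- by move=> p a i; rewrite hs chs; apply: (column_nest C).
exists (map (scale_rigged m) U); rewrite selS; split.
- suff <- : nonempty_rows (St t) = St t by apply: XU.
  apply/all_filterP; rewrite all_map; apply: sub_all Spos => q.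
  exact: posE.
- rewrite shrink_nonempty_rows -map_comp (eq_map (_ : _ =1 fun q => (q.1, m * q.2 - t.+1))).
    exact: XU.
  by move=> q /=; rewrite subnS.
(* Singularity in [X t] makes m * v the mean of two vacancy numbers, both at least v. The weight m -
   t of the first one is positive, so the row was already singular in [x]. *)
move=> a i j /mapP[[[b l] v] yU [? ? V]] jr ja; rewrite chs !hs; subst b i.
have -> : (m * l + t) %/ m = l by rewrite mulnC divnMDl// divn_small ?addn0.
apply: hitU => //; suff <- : v = row_vacancy x a l by [].
have yx : ((a, l), v) \in rigged x by rewrite (perm_mem xU) mem_cat yU.
have yz : ((a, l), v) \in rigged z by rewrite (perm_mem zU) mem_cat yU.
have /(_ _ yx)/= /andP[_ vx] := let: And4 _ _ _ h := xRC in h.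
have /(_ _ yz)/= /andP[_ vz] := let: And4 _ _ _ h := zRC in h.
move: V; have := vacX a (ltnW tm) (_ : l <= l <= l.+1).
rewrite leqnn leqnSn -mulnDl subnK ?(ltnW tm)// => /(_ isT) -> /esym V.
have p0 : (0 < Posz (m - t))%R by rewrite ltz_nat subn_gt0.
have mE : (Posz m = Posz (m - t) + Posz t)%R by rewrite -PoszD subnK// ltnW.
move: V; rewrite -mulr_natl natz mE => V; apply/eqP; rewrite eq_le vx /=.
move: (row_vacancy x a l) (row_vacancy z a l) vx vz V p0 => vX vZ.
by clear; move: (Posz (m - t)) => p; nia.
Qed.

Lemma scaled_start : X 0 = sim_RC m x.
Proof.
apply: rigged_configuration_eq.
  apply/eq_seq_msetP; rewrite /Lt subn0.
  have -> : nonempty_rows ((r, m * k) :: map (scale_row m) L) = map (scale_row m) ((r, k) :: L).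
    apply/all_filterP; rewrite /= muln_gt0 m0 k0 /= all_map.
    by apply: sub_all Lpos => q /= q0; rewrite muln_gt0 m0.
  by rewrite perm_map// perm_sym.
rewrite -[LHS]seq_mset_id; apply/eq_seq_msetP; rewrite (permPl (XU 0)).
have -> : nonempty_rows (St 0) = map (scale_row m) S.
  have -> : St 0 = map (scale_row m) S by apply: eq_map => q; rewrite subn0.
  apply/all_filterP; rewrite all_map.
  by apply: sub_all Spos => q /= q0; rewrite muln_gt0 m0.
rewrite perm_sym (permPl (perm_map _ xU)) map_cat perm_cat2l.
rewrite (_ : map _ _ = rows_with (row_vacancy (X 0)) (map (scale_row m) S))//.
rewrite /rows_with -!map_comp; apply: eq_map => -[a l] /=; congr pair.
have := @vacX 0 a l l isT; rewrite leqnn leqnSn subn0 => /(_ isT).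
by rewrite mul0n addn0 mul0r addr0 => ->; rewrite -mulr_natl natz.
Qed.

Lemma scaled_end : X m = sim_RC m z.
Proof.
apply: rigged_configuration_eq.
  apply/eq_seq_msetP; rewrite /Lt perm_sym (permPl (perm_map _ multz)).
  rewrite /nonempty_rows /= -subn1.
  have -> : (0 < m * k - m) = (0 < k - 1) by rewrite -{2}[m]muln1 -mulnBr muln_gt0 m0.
  have -> : [seq q <- map (scale_row m) L | 0 < q.2] = map (scale_row m) [seq q <- L | 0 < q.2].
    by rewrite filter_map; congr map; apply: eq_filter => q /=; rewrite muln_gt0 m0.
  by case: ifP => //=; rewrite /scale_row /= mulnBr muln1.
rewrite -[LHS]seq_mset_id; apply/eq_seq_msetP; rewrite (permPl (XU m)).
have StE : St m = map (scale_row m) [seq (q.1, q.2.-1) | q <- S].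
  by rewrite -map_comp; apply: eq_map => q /=; rewrite /scale_row /= -subn1 mulnBr muln1.
have -> : nonempty_rows (St m) = map (scale_row m) (shrink S).
  rewrite StE shrink_nonempty_rows /nonempty_rows filter_map; congr map.
  by apply: eq_filter => q /=; rewrite muln_gt0 m0.
rewrite perm_sym (permPl (perm_map _ zU)) map_cat perm_cat2l.
rewrite (_ : map _ _ =
  rows_with (row_vacancy (X m)) (map (scale_row m) (shrink S)))//.
rewrite /rows_with -!map_comp; apply: eq_map => -[a l] /=; congr pair.
have := @vacX m a l.-1 l.-1 (leqnn m); rewrite leqnn leqnSn subnn => /(_ isT).
by rewrite mul0n add0n mul0r add0r => ->; rewrite -mulr_natl natz.
Qed.

End Scaling.

Lemma scaled_columns n r k m x z Lx Lz L sel :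
  0 < m -> 0 < k -> RC n Lx x -> RC n Lz z -> column_removal n r k x z sel ->
  perm_eq (mult x) ((r, k) :: L) ->
  perm_eq (mult z) (nonempty_rows ((r, k.-1) :: L)) -> all (fun q => 0 < q.2) L ->
  exists X : nat -> rigged_configuration, [/\ X 0 = sim_RC m x,
    X m = sim_RC m z,
    forall t, mult (X t) = seq_mset (nonempty_rows ((r, m * k - t) :: map (scale_row m) L))
  & forall t, t < m -> exists sel',
      column_removal n r (m * k - t) (X t) (X t.+1) sel'].
Proof.
move=> m0 k0 xRC zRC C multx multz Lpos; have [U [xU zU hitU]] := column_perm C.
exists (fun t => add_singular
  (seq_mset (nonempty_rows ((r, m * k - t) :: map (scale_row m) L)))
  (seq_mset (map (scale_rigged m) U))
  (nonempty_rows [seq (q.1, m * q.2 - t) | q <- selected r sel 0])).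
split=> //.
- exact: (scaled_start m0 k0 C multx multz Lpos xU zU).
- exact: (scaled_end m0 k0 C multx multz Lpos xU zU).
move=> t tm; exists (fun j => [seq (q.1, m * q.2 - t) | q <- sel j]).
exact: (column_removal_scaled m0 k0 xRC zRC C multx multz Lpos xU zU hitU).
Qed.

Lemma row_vacancy0 x a : row_vacancy x a 0 = 0%R.
Proof.
by rewrite /row_vacancy /vacancy !big1 ?subr0// => q _; rewrite min0n ?mulr0.
Qed.

Lemma sim_RC_vacancy m x a t i i' : t <= m -> i' <= i <= i'.+1 ->
  (row_vacancy (sim_RC m x) a ((m - t) * i + t * i') =
     (m - t)%:Z * row_vacancy x a i + t%:Z * row_vacancy x a i')%R.
Proof.
move=> tm ii'.
have smx : perm_eq (mult (sim_RC m x)) (map (scale_row m) (mult x)).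
  exact: perm_eq_seq_mset.
have srx : perm_eq (rigged (sim_RC m x)) (map (scale_rigged m) (rigged x)).
  exact: perm_eq_seq_mset.
rewrite (row_vacancy_vac _ _ smx srx).
rewrite !(row_vacancy_vac _ _ (perm_refl (mult x)) (perm_refl (rigged x))).
pose l := [seq (q.1, (q.2, q.2)) | q <- mult x].
pose s := [seq (y.1.1, (y.1.2, y.1.2)) | y <- rigged x].
have sl : all slow l.
  by rewrite /l /= all_map /slow /=; apply/allP => q _ /=; lia.
have ss : all slow s.
  by rewrite /s /= all_map /slow /=; apply/allP => q _ /=; lia.
have arith p : (m - t) * p + t * p = m * p by rewrite -mulnDl subnK.
have := vac_interpolation (m - t) t a sl ss ii'.
have -> : map (interpolate (m - t) t) l = map (scale_row m) (mult x).
  by rewrite -map_comp; apply: eq_map => q; rewrite /interpolate /= arith.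
have -> : map (interpolate (m - t) t) s = map fst (map (scale_rigged m) (rigged x)).
  by rewrite -!map_comp; apply: eq_map => q; rewrite /interpolate /= arith.
have -> : [seq (q.1, q.2.1) | q <- l] = mult x by rewrite -map_comp map_id_in// => -[].
have -> : [seq (q.1, q.2.2) | q <- l] = mult x by rewrite -map_comp map_id_in// => -[].
have -> : [seq (q.1, q.2.1) | q <- s] = map fst (rigged x).
  by rewrite -map_comp; apply: eq_map => -[[]].
have -> // : [seq (q.1, q.2.2) | q <- s] = map fst (rigged x).
by rewrite -map_comp; apply: eq_map => -[[]].
Qed.

Lemma sim_RC_vacancyM m x a i :
  row_vacancy (sim_RC m x) a (m * i) = (row_vacancy x a i *+ m)%R.
Proof.
have := @sim_RC_vacancy m x a 0 i i isT; rewrite leqnn leqnSn subn0 => /(_ isT).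
by rewrite mul0n addn0 mul0r addr0 => ->; rewrite -mulr_natl natz.
Qed.

Lemma RC_sim n m B x : 0 < m -> RC n (crystal_mult B) x ->
  RC n (crystal_mult (sim_crystal m B)) (sim_RC m x).
Proof.
move=> m0 [multx pos vac0 rig].
have memS y : y \in rigged (sim_RC m x) ->
    exists2 y', y' \in rigged x & y = scale_rigged m y'.
  by rewrite (perm_mem (perm_eq_seq_mset _)) => /mapP.
split.
- rewrite /= multx; apply/eq_seq_msetP; rewrite perm_map//.
  exact: perm_eq_seq_mset.
- by move=> _ /memS[y /pos yp ->] /=; rewrite muln_gt0 m0.
- move=> a i an i0; rewrite (divn_eq i m).
  have mi : i %% m < m by rewrite ltn_mod.
  (* With i = m d + e this writes i as e (d + 1) + (m - e) d, so a vacancy number at a length not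
     divisible by m is an average of nonnegative ones. *)
  have -> : i %/ m * m + i %% m = (m - (m - i %% m)) * (i %/ m).+1 + (m - i %% m) * (i %/ m).
    rewrite subKn; last exact: ltnW.
    move: (i %/ m) (i %% m) mi => d e em; rewrite mulnS mulnBl.
    by have := leq_mul (ltnW em) (leqnn d); rewrite (mulnC d m); lia.
  rewrite sim_RC_vacancy ?leq_subr ?leqnn ?leqnSn//.
  rewrite addr_ge0// mulr_ge0//; first exact: vac0.
  by case: (i %/ m) => [|d]; [rewrite row_vacancy0|apply: vac0].
- move=> _ /memS[y yx ->] /=; have /andP[y0 yv] := rig y yx.
  by rewrite sim_RC_vacancyM mulrn_wge0// lerMn2r yv orbT.
Qed.

(** * Highest weight paths *)

Definition lattice (i : nat) (w : seq nat) :=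
  forall k, count_mem i.+1 (drop k w) <= count_mem i (drop k w).

Lemma lattice_cons i c w : lattice i (c :: w) <->
  lattice i w /\ count_mem i.+1 (c :: w) <= count_mem i (c :: w).
Proof.
split=> [l|[l cw] [|k]]; [split|by rewrite drop0|exact: l].
  by move=> k; apply: (l k.+1).
by have := l 0; rewrite drop0.
Qed.

Lemma lattice_catr i u v : lattice i (u ++ v) -> lattice i v.
Proof. by elim: u => //= c u IHu /lattice_cons[/IHu]. Qed.

Lemma count_mem_gt (w : seq nat) c i : path leq c w -> i < c -> count_mem i w = 0.
Proof.
rewrite path_sortedE; last exact: leq_trans.
case/andP=> /allP cw _ ic; apply/count_memPn/negP => /cw.
by rewrite leqNgt ic.
Qed.

(* Reading [u] from the right, all letters [i+1] come before the letters [i]. *)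
Lemma lattice_row i u v : sorted leq u ->
  lattice i (u ++ v) <->
  lattice i v /\ count_mem i.+1 u + count_mem i.+1 v <= count_mem i v.
Proof.
elim: u => [_|c u IHu cu].
  by split=> [l|[]//]; split=> //; have := l 0; rewrite drop0.
have [IH1 IH2] := IHu (path_sorted cu); rewrite /=; split.
  case/lattice_cons=> /IH1[l uv] /=; rewrite !count_cat => cuv; split=> //.
  have [ci|//] := eqVneq c i.+1; move: cuv.
  have -> : count_mem i u = 0 by apply: count_mem_gt cu _; rewrite ci.
  by rewrite ci eqxx (gtn_eqF (ltnSn i)) /=; lia.
move=> [l uv]; apply/lattice_cons; split.
  by apply: IH2; split=> //; apply: leq_trans uv; rewrite leq_add2r leq_addl.
by rewrite /= !count_cat addnA (leq_trans uv)// addnA leq_addl.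
Qed.

(* [N'] and [N] count the letters [i+1] and [i] to the right; the condition is
   the strongest at the leftmost letter [i+1] of each row. *)
Fixpoint rows_ok (i N' N : nat) (T : tableau) : bool :=
  if T is w :: T' then
    (count_mem i.+1 w + N' <= N)
    && rows_ok i (count_mem i.+1 w + N') (count_mem i w + N) T'
  else true.

Lemma tableau_word_cons w T : tableau_word (w :: T) = tableau_word T ++ w.
Proof. by rewrite /tableau_word rev_cons -cats1 flatten_cat /= cats0. Qed.

Lemma lattice_tableau i T v : all (sorted leq) T ->
  lattice i (tableau_word T ++ v) <->
  lattice i v /\ rows_ok i (count_mem i.+1 v) (count_mem i v) T.
Proof.
elim: T v => [v _|w T IHT v /= /andP[sw sT]]; first by split=> [|[]].
rewrite tableau_word_cons -catA IHT// lattice_row// !count_cat.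
split=> [[[lv ->] ->]//|[lv /andP[-> ->]]//].
Qed.

Lemma rows_ok_final i N' N T : N' <= N -> rows_ok i N' N T ->
  count_mem i.+1 (flatten T) + N' <= count_mem i (flatten T) + N.
Proof.
elim: T N' N => //= w T IHT N' N _ /andP[wN]; rewrite !count_cat.
by move=> /(IHT _ _ (leq_trans wN (leq_addl _ _))); lia.
Qed.

Lemma rows_ok0 i N' N T : N' <= N ->
  all (fun w => (count_mem i w == 0) && (count_mem i.+1 w == 0)) T ->
  rows_ok i N' N T.
Proof.
by elim: T => //= w T IHT NN /andP[/andP[/eqP-> /eqP->] /(IHT NN)->]; rewrite NN.
Qed.

Definition first_column (T : tableau) := map (take 1) T.
Definition other_columns (T : tableau) := map behead T.

(** Letters of the first column strictly increase. While the head is below i, the first column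
    contributes no i or i + 1; once it exceeds i, no later row can contain i. Only the row with head
    i and the one under it need a comparison. *)
Lemma rows_ok_split i N' N T : N' <= N ->
  all (fun w => (w != [::]) && sorted leq w) T ->
  sorted ltn (map (head 0) T) -> rows_ok i N' N T ->
  rows_ok i N' N (other_columns T) /\
  rows_ok i (count_mem i.+1 (flatten (other_columns T)) + N')
    (count_mem i (flatten (other_columns T)) + N) (first_column T).
Proof.
pose absent w := (count_mem i w == 0) && (count_mem i.+1 w == 0).
have zero c T' : i < c -> all (fun w => (w != [::]) && sorted leq w) T' ->
    path ltn c (map (head 0) T') ->
    [/\ all absent (other_columns T'), all absent (first_column T'),
      count_mem i (flatten (other_columns T')) = 0
      & count_mem i.+1 (flatten (other_columns T')) = 0].
  elim: T' c => //= -[//|h w] T' IHT c ic /andP[/= hw sT] /andP[ch hT].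
  have ih : i.+1 < h by apply: leq_ltn_trans ch.
  have [-> -> E1 E2] := IHT h (ltnW ih) sT hT.
  have w1 : count_mem i w = 0 by apply: count_mem_gt hw _; apply: ltnW.
  have w2 : count_mem i.+1 w = 0 by apply: count_mem_gt hw _.
  rewrite !count_cat E1 E2 take0 /absent /= w1 w2.
  by rewrite (gtn_eqF (ltn_trans (ltnSn i) ih)) (gtn_eqF ih).
elim: T N' N => //= -[//|h w] T IHT N' N NN /andP[/= hw sT] hT /andP[].
rewrite take0 /= addn0 !count_cat => wN okT.
have [hi|ih|hi] := ltngtP h i.
- have nh : (h == i.+1) = false by rewrite ltn_eqF// ltnW.
  rewrite nh (ltn_eqF hi) !add0n in wN okT *.
  have [] := IHT _ _ _ sT (path_sorted hT) okT; first by lia.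
  move=> okR okC; rewrite wN okR; split=> //.
  have := rows_ok_final _ okR.
  rewrite ![count_mem _ w + count_mem _ (flatten _)]addnC -!addnA okC => -> //.
  by lia.
- have w0 : count_mem i w = 0 by apply: count_mem_gt hw _.
  rewrite (gtn_eqF ih) w0 !add0n in wN okT *.
  have [zR zC -> ->] := zero h T ih sT hT.
  rewrite !rows_ok0//; [lia|lia|].
  by move: wN; case: eqP; lia.
rewrite hi eqxx ltn_eqF// add0n add1n addSn in hw hT wN okT *.
case: T sT hT okT {IHT} => [|[//|h' w'] T] /=; first by move=> *; split; lia.
move=> /andP[/= hw' sT] /andP[ih' hT]; rewrite take0 /= addn0 !count_cat.
have [zR zC -> ->] := zero h' T ih' sT hT.
have w0 : count_mem i w' = 0 by apply: count_mem_gt hw' _.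
rewrite (gtn_eqF ih') w0 !add0n => /andP[wN' _].
have [h1|h1] := eqVneq h' i.+1.
  by rewrite !rows_ok0//; [split|..]; lia.
have w1 : count_mem i.+1 w' = 0 by apply: count_mem_gt hw' _; lia.
by rewrite w1 !rows_ok0//; [split|..]; lia.
Qed.

Lemma row_word_cons T b : row_word (T :: b) = tableau_word T ++ row_word b.
Proof. by []. Qed.

Lemma highest_weightP n b :
  highest_weight n b <-> forall i, 1 <= i <= n -> lattice i (row_word b).
Proof. by split=> h i; [move=> i_n k; apply: h|move=> k /h; apply]. Qed.

Lemma tableauP n r s T : reflect [/\ size T = r,
    {in T, forall w, [/\ size w = s, sorted leq w & {in w, forall c, 1 <= c <= n.+1}]}
    & sorted (fun u v => all2 ltn u v) T] (is_tableau n (r, s) T).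
Proof.
apply: (iffP and3P) => /= [[/eqP rT /allP sT cT]|[rT sT cT]]; split=> //.
- by move=> w /sT/and3P[/eqP -> -> /allP].
- exact/eqP.
- by apply/allP => w /sT[-> -> /allP ->]; rewrite eqxx.
Qed.

Lemma tableau_first_column n r s T : 0 < s -> is_tableau n (r, s) T ->
  is_tableau n (r, 1) (first_column T).
Proof.
move=> s0 /tableauP[rT sT cT]; apply/tableauP; split; first by rewrite size_map.
  move=> _ /mapP[w /sT[ws sw lw] ->]; split.
  - by rewrite size_take ws; case: (s) s0 => [|[]].
  - exact: take_sorted.
  - by move=> c /mem_take/lw.
rewrite sorted_map; apply: sub_sorted cT => -[|a u] [|b v] //=.
by rewrite !take0 => /andP[->].
Qed.

Lemma first_column_id n r T : is_tableau n (r, 1) T -> first_column T = T.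
Proof.
move=> /tableauP[_ sT _]; rewrite -[RHS]map_id; apply/eq_in_map => w /sT[w1 _ _].
by rewrite take_oversize// w1.
Qed.

Lemma tableau_other_columns n r s T : 1 < s -> is_tableau n (r, s) T ->
  is_tableau n (r, s.-1) (other_columns T).
Proof.
move=> s0 /tableauP[rT sT cT]; apply/tableauP; split; first by rewrite size_map.
  move=> _ /mapP[w /sT[ws sw lw] ->]; split.
  - by rewrite size_behead ws.
  - by case: (w) sw => //= a u /path_sorted.
  - by move=> c /mem_behead/lw.
rewrite sorted_map; apply: sub_sorted cT => -[|a u] [|b v] //=.
by case/andP.
Qed.

Lemma tableau_heads n r s T : 0 < s -> is_tableau n (r, s) T ->
  all (fun w => (w != [::]) && sorted leq w) T /\ sorted ltn (map (head 0) T).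
Proof.
move=> s0 /tableauP[rT sT cT].
have neT w : w \in T -> w != [::].
  by move=> /sT[ws _ _]; rewrite -size_eq0 ws -lt0n.
split; first by apply/allP => w wT; rewrite neT//; have [_ ->] := sT w wT.
rewrite sorted_map; apply: (sub_in_sorted (P := [pred w | w != [::]])) cT.
  by move=> [//|a u] [//|b v] _ _ /= /andP[].
by apply/allP.
Qed.

Lemma all_sorted_tableau n q T : is_tableau n q T -> all (sorted leq) T.
Proof. by case: q => r s /tableauP[_ sT _]; apply/allP => w /sT[]. Qed.

Lemma count_tableau_word i T : count_mem i (tableau_word T) = count_mem i (flatten T).
Proof. by apply/permP; rewrite perm_flatten// perm_rev. Qed.

Lemma lattice_split n r s T v i : 0 < s -> is_tableau n (r, s) T ->
  lattice i (tableau_word T ++ v) ->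
  lattice i (tableau_word (first_column T) ++ tableau_word (other_columns T) ++ v).
Proof.
move=> s0 tT; have sT := all_sorted_tableau tT.
move=> /(lattice_tableau _ _ sT)[lv okT].
have [neT hT] := tableau_heads s0 tT.
have v0 : count_mem i.+1 v <= count_mem i v by have := lv 0; rewrite drop0.
have [okR okC] := rows_ok_split v0 neT hT okT.
have sR : all (sorted leq) (other_columns T).
  by rewrite all_map; apply: (sub_all _ sT); case=> //= a u /path_sorted.
have sC : all (sorted leq) (first_column T).
  rewrite all_map; apply: (sub_all _ sT) => w; exact: take_sorted.
apply/(lattice_tableau _ _ sC); split; first exact/(lattice_tableau _ _ sR).
by rewrite !count_cat !count_tableau_word.
Qed.

Lemma paths_cons n q B T b : paths n (q :: B) (T :: b) <->
  [/\ is_tableau n q T, all2 (is_tableau n) B b & highest_weight n (T :: b)].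
Proof. by split=> [[/andP[]]|[h1 h2 h3]]//; split=> //=; rewrite h1. Qed.

Lemma paths_behead n q B T b : paths n (q :: B) (T :: b) -> paths n B b.
Proof.
move=> /paths_cons[_ tb /highest_weightP hw]; split=> //; apply/highest_weightP.
by move=> i i_n; apply: (lattice_catr (hw i i_n)).
Qed.

Lemma paths_ls n r s B T b : 0 < s -> paths n ((r, s) :: B) (T :: b) ->
  highest_weight n (first_column T :: other_columns T :: b).
Proof.
move=> s0 /paths_cons[tT tb /highest_weightP hw]; apply/highest_weightP => i i_n.
exact: (lattice_split s0 tT (hw i i_n)).
Qed.

Lemma ls_path n r s B T b : 1 < s -> paths n ((r, s) :: B) (T :: b) ->
  paths n [:: (r, 1), (r, s.-1) & B] (ls (T :: b)).
Proof.
move=> s1 p; have [tT tb _] := (paths_cons n (r, s) B T b).1 p.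
apply/paths_cons; split; [|apply/andP; split => //|].
- by apply: tableau_first_column tT; apply: ltnW.
- exact: tableau_other_columns tT.
- exact: paths_ls (ltnW s1) p.
Qed.

Lemma count_ls i T b : all (fun w : seq nat => w != [::]) T ->
  count_mem i (row_word (ls (T :: b))) = count_mem i (row_word (T :: b)).
Proof.
move=> neT; rewrite /ls !row_word_cons !count_cat !count_tableau_word addnA.
congr (_ + _); elim: T neT => //= -[//|a u] T IHT /= /IHT.
by rewrite !count_cat take0 /=; lia.
Qed.

Lemma row_word_lb T w b :
  row_word (lb (rcons T w :: b)) = row_word (rcons T w :: b).
Proof.
rewrite /lb last_rcons size_rcons -cats1 take_size_cat//.
by rewrite !row_word_cons /tableau_word rev_cat /= cats0 catA.
Qed.

Lemma tableau_rcons n r s T w : is_tableau n (r.+1, s) (rcons T w) ->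
  is_tableau n (1, s) [:: w] /\ is_tableau n (r, s) T.
Proof.
move=> /tableauP[]; rewrite size_rcons => -[rT] sT cT; split; apply/tableauP.
  by split=> // w'; rewrite inE => /eqP->; apply: sT; rewrite mem_rcons mem_head.
split=> //; first by move=> w' w'T; apply: sT; rewrite mem_rcons inE w'T orbT.
by case: (T) cT => //= u T'; rewrite rcons_path => /andP[].
Qed.

Lemma lb_path n r B T w b : paths n ((r.+1, 1) :: B) (rcons T w :: b) ->
  paths n [:: (1, 1), (r, 1) & B] (lb (rcons T w :: b)).
Proof.
move=> /paths_cons[/tableau_rcons[tw tT] tb hw]; split.
  rewrite /lb last_rcons size_rcons -cats1 take_size_cat// /= tb andbT.
  by apply/andP; split.
by apply/highest_weightP; rewrite row_word_lb; apply/highest_weightP.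
Qed.

(** * Column removal on paths and its image under [Phi] *)

Definition partial_crystal (B : crystal) (j : nat) : crystal :=
  if j is _.+1 then (j, 1) :: B else B.

Definition partial_path (T : tableau) (b : seq tableau) (j : nat) :=
  if j is _.+1 then take j T :: b else b.

Definition column_crystal (B : crystal) (r k : nat) : crystal :=
  if 1 < k then (r, k.-1) :: B else B.

Definition column_path (k : nat) (T : tableau) (b : seq tableau) :=
  if 1 < k then other_columns T :: b else b.

Section KSS.

Variables (n : nat) (Phi : crystal -> seq tableau -> rigged_configuration).
Hypothesis KSS : is_KSS_bijection n Phi.

Lemma KSS_RC B b : wf_crystal n B -> paths n B b -> RC n (crystal_mult B) (Phi B b).
Proof. by move=> wB pb; have [f _ _] := KSS_bij KSS wB; apply: f. Qed.

Lemma KSS_inj B b b' : wf_crystal n B -> paths n B b -> paths n B b' ->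
  Phi B b = Phi B b' -> b = b'.
Proof.
by move=> wB pb pb'; have [_ f _] := KSS_bij KSS wB; apply: f; rewrite inE.
Qed.

Lemma KSS_surj B x : wf_crystal n B -> RC n (crystal_mult B) x ->
  exists2 b, paths n B b & Phi B b = x.
Proof. by move=> wB rx; have [_ _ f] := KSS_bij KSS wB; apply: f. Qed.

Lemma KSS_mult B b : wf_crystal n B -> paths n B b -> mult (Phi B b) = seq_mset B.
Proof. by move=> wB /(KSS_RC wB)[]. Qed.

(** Removing the lowest letter of a column is [lb] followed by [lh], or [lh] alone at height 1;
    [unboxed] makes the same case distinction. *)
Lemma KSS_partial B T b j : wf_crystal n (partial_crystal B j.+1) -> j < size T ->
  paths n (partial_crystal B j.+1) (partial_path T b j.+1) ->
  [/\ wf_crystal n (partial_crystal B j),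
    paths n (partial_crystal B j) (partial_path T b j)
  & box_removal n j.+1 (Phi (partial_crystal B j.+1) (partial_path T b j.+1))
      (Phi (partial_crystal B j) (partial_path T b j))
      (box_selection n j.+1 (Phi (partial_crystal B j.+1) (partial_path T b j.+1)))].
Proof.
move=> wB jT pb; have wB' : wf_crystal n (partial_crystal B j).
  by move: wB; case: (j) => //= [|i] /andP[+ ->]; rewrite /wf_factor ?andbT //=; lia.
have jn : j.+1 <= n by move: wB => /= /andP[/andP[]].
suff [p <-] : paths n (partial_crystal B j) (partial_path T b j) /\
    delta n (unboxed j.+1 (Phi (partial_crystal B j.+1) (partial_path T b j.+1))) =
    Phi (partial_crystal B j) (partial_path T b j).
  by split=> //; apply: box_removal_delta => //; apply: KSS_mult.
case: j jT jn wB wB' pb => [|j] jT jn wB wB' /= pb.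
  split; first exact: paths_behead pb.
  by rewrite /unboxed /= -(KSS_lh KSS wB pb).
have Tj : take j.+2 T = rcons (take j.+1 T) (nth [::] T j.+1).
  by rewrite -take_nth.
rewrite Tj in pb *; have plb := lb_path pb.
have wlb : wf_crystal n [:: (1, 1), (j.+1, 1) & B].
  by move: wB' => /= ->; rewrite /wf_factor /= andbT; lia.
have lbE : lb (rcons (take j.+1 T) (nth [::] T j.+1) :: b) =
    [:: [:: nth [::] T j.+1], take j.+1 T & b].
  by rewrite /lb last_rcons size_rcons -cats1 take_size_cat.
split; first by have := plb; rewrite lbE => /paths_behead.
rewrite /unboxed /= -(KSS_lb KSS (isT : 1 < j.+2) wB pb) -(KSS_lh KSS wlb plb).
by rewrite lbE.
Qed.

Section Column.

Variables (B : crystal) (r k : nat) (T : tableau) (b : seq tableau).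
Hypotheses (wB : wf_crystal n ((r, k) :: B)) (pb : paths n ((r, k) :: B) (T :: b)).

Let k0 : 0 < k. Proof. by move: wB => /= /andP[/andP[]]. Qed.
Let r1n : 0 < r <= n. Proof. by move: wB => /= /andP[/andP[]]. Qed.

Let B' := column_crystal B r k.
Let b' := column_path k T b.
Let T' := first_column T.

Definition column_state j := Phi (partial_crystal B' j) (partial_path T' b' j).
Definition column_selection j := box_selection n j (column_state j).

Lemma size_column : size T' = r.
Proof. by have [/tableauP[rT _ _] _ _] := (paths_cons _ _ _ _ _).1 pb; rewrite size_map. Qed.

Lemma column_top : wf_crystal n (partial_crystal B' r) /\
  paths n (partial_crystal B' r) (partial_path T' b' r).
Proof.
have [tT tb hw] := (paths_cons _ _ _ _ _).1 pb.
case: r r1n wB pb tT @B' size_column => // r' r1n' wB' pb' tT; rewrite /column_crystal /b' /column_path.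
move=> sT; rewrite /= take_oversize ?sT//; case: ltnP => k1.
  split; last exact: ls_path pb'.
  by move: wB'; rewrite /= /wf_factor /= => /andP[_ ->]; lia.
have k_eq1 : k = 1 by lia.
rewrite k_eq1 in wB' pb' tT *; rewrite /T' (first_column_id tT).
by split.
Qed.

Lemma column_states j : j <= r -> wf_crystal n (partial_crystal B' j) /\
  paths n (partial_crystal B' j) (partial_path T' b' j).
Proof.
move=> jr; have [d ->] : exists d, j = r - d by exists (r - j); lia.
elim: d => [|d IHd]; first by rewrite subn0; apply: column_top.
have [->//|rd] := eqVneq (r - d.+1) (r - d).
have E : r - d = (r - d.+1).+1 by lia.
move: IHd; rewrite E => -[w p].
have jT : r - d.+1 < size T' by rewrite size_column; lia.
by have [] := KSS_partial w jT p.
Qed.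

Lemma column_boxes j : 0 < j <= r ->
  box_removal n j (column_state j) (column_state j.-1) (column_selection j).
Proof.
case: j => // j /= jr; have [w p] := column_states jr.
have jT : j < size T' by rewrite size_column.
by have [] := KSS_partial w jT p.
Qed.

Lemma column_top_rigged : rigged (column_state r) = rigged (Phi ((r, k) :: B) (T :: b)).
Proof.
rewrite /column_state /B' /b' /column_crystal /column_path.
have := size_column; case: r r1n wB pb => // r' ? wB' pb' sT.
rewrite /= take_oversize ?sT//; case: ltnP => k1.
  by rewrite -[_ :: _ :: b]/(ls (T :: b)) (KSS_ls KSS k1 wB' pb').
have k_eq1 : k = 1 by lia.
have [tT _ _] := (paths_cons _ _ _ _ _).1 pb'.
by rewrite k_eq1 in tT *; rewrite /T' (first_column_id tT).
Qed.

(** For i > 0 the difference min(i, 1) + min(i, k - 1) - min(i, k) is 1 if i < k and 0 otherwise;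
    for k = 1 nothing is split off. *)
Lemma column_top_vacancy a i : 0 < a -> 0 < i ->
  (row_vacancy (column_state r) a i =
   row_vacancy (Phi ((r, k) :: B) (T :: b)) a i + ((a == r) && (i < k)%N)%:Z)%R.
Proof.
move=> a0 i0; have [w p] := column_top.
have multE : mult (column_state r) = seq_mset ((r, 1) :: B').
  by rewrite /column_state (KSS_mult w p); case: (r) r1n.
have m1 : perm_eq (mult (column_state r)) ((r, 1) :: B').
  by rewrite multE perm_eq_seq_mset.
have m2 : perm_eq (mult (Phi ((r, k) :: B) (T :: b))) ((r, k) :: B).
  by rewrite (KSS_mult wB pb) perm_eq_seq_mset.
rewrite (row_vacancy_vac _ _ m1 (perm_refl _)) column_top_rigged.
rewrite (row_vacancy_vac _ _ m2 (perm_refl _)) /B' /column_crystal.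
by rewrite eq_sym; case: ltnP => k1; rewrite !vac_cons; case: eqP => _ /=; lia.
Qed.

Lemma column_removal_KSS :
  column_removal n r k (Phi ((r, k) :: B) (T :: b)) (Phi B' b') column_selection.
Proof.
exact: (column_removal_boxes (KSS_RC wB pb) column_top_rigged column_top_vacancy
  column_boxes).
Qed.

Lemma column_rest : wf_crystal n B' /\ paths n B' b'.
Proof. exact: (column_states (leq0n r)). Qed.

End Column.

End KSS.

(** * Weights *)

(* The vacancy number at length infinity. *)
Definition gap (x : rigged_configuration) (a : nat) : int :=
  (\sum_(q <- mult x | q.1 == a) q.2%:Z
   - \sum_(q <- config (rigged x)) cartan a q.1 * q.2%:Z)%R.

Lemma row_vacancy_gap x : exists M, forall a i, M <= i ->
  row_vacancy x a i = gap x a.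
Proof.
exists (\max_(q <- mult x) q.2 + \max_(q <- config (rigged x)) q.2) => a i Mi.
have mle (s : seq (nat * nat)) q : q \in s -> q.2 <= \max_(p <- s) p.2.
  by move=> qs; rewrite (big_rem q)//= leq_maxl.
rewrite /row_vacancy /vacancy /gap; congr (_ - _)%R.
  rewrite big_seq_cond [RHS]big_seq_cond; apply: eq_bigr => q /andP[/mle qM _].
  by rewrite (minn_idPr _)// (leq_trans qM)// (leq_trans _ Mi)// leq_addr.
rewrite big_seq [RHS]big_seq; apply: eq_bigr => q /mle qM.
by rewrite (minn_idPr _)// (leq_trans qM)// (leq_trans _ Mi)// leq_addl.
Qed.

Lemma eq_gap x y a M :
  (forall i, M <= i -> row_vacancy x a i = row_vacancy y a i) -> gap x a = gap y a.
Proof.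
move=> xy; have [Mx Ex] := row_vacancy_gap x; have [My Ey] := row_vacancy_gap y.
have iM : M <= M + Mx + My /\ Mx <= M + Mx + My /\ My <= M + Mx + My by lia.
by rewrite -(Ex a (M + Mx + My)) ?xy ?(Ey a)//; case: iM => ? [].
Qed.

Lemma gap_ge0 n L x a : RC n L x -> 0 < a <= n -> (0 <= gap x a)%R.
Proof.
move=> [_ _ pos _] an; have [M E] := row_vacancy_gap x.
by rewrite -(E a M.+1)// pos.
Qed.

Lemma hit_all (s : seq (nat * nat)) j a : map fst s = iota j (size s) ->
  exists M, forall i, M <= i -> hit s a i = (j <= a < j + size s).
Proof.
move=> sj; exists (\max_(p <- s) p.2) => i Mi; apply/idP/idP.
  exact: hit_fst_iota.
rewrite -mem_iota -sj => /mapP[[b l] bl /= ->]; apply/hitP; exists l => //.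
by apply: leq_trans Mi; rewrite (big_rem (b, l))//= leq_maxl.
Qed.

(** At large lengths [hit] is the indicator of the colours q, ..., q + |s| - 1. Its second
    difference and the change of the multiplicity array cancel at the lower end, leaving the weight
    of the letter q + |s|. *)
Lemma gap_box n q x y s a : 0 < q -> box_removal n q x y s -> 0 < a ->
  (gap x a = gap y a + (a == q + size s)%:Z - (a.+1 == q + size s)%:Z)%R.
Proof.
move=> q0 B a0; have sq := box_fst B.
have [M1 E1] := hit_all a sq; have [M2 E2] := hit_all a.-1 sq.
have [M3 E3] := hit_all a.+1 sq.
have [Mx Ex] := row_vacancy_gap x; have [My Ey] := row_vacancy_gap y.
pose i := (M1 + M2 + M3 + Mx + My).+1.
have [le1 le2 le3 lex ley] : [/\ M1 <= i, M2 <= i, M3 <= i, Mx <= i & My <= i].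
  by rewrite /i; split; lia.
have := box_vacancy B a0 (ltn0Sn _ : 0 < i).
rewrite E1// E2// E3// (Ex _ _ lex) (Ey _ _ ley); clear -q0 a0; lia.
Qed.

(* The selection can be recovered from the top colour downwards: the selected
   row of [y] would otherwise be a row of [x] with a rigging that is too large. *)
Lemma box_removal_inj n q x y z s t Lx Ly : 0 < q ->
  box_removal n q x z s -> box_removal n q y z t ->
  RC n Lx x -> RC n Ly y -> mult x = mult y -> size s = size t -> x = y.
Proof.
move=> q0; have half x' y' s' t' L a l l' : box_removal n q x' z s' ->
    box_removal n q y' z t' -> RC n L x' ->
    (forall i, hit s' a.+1 i -> hit t' a.+1 i) ->
    (a, l) \in s' -> (a, l') \in t' -> l' <= l.
  move=> B B' xRC hst al al'; rewrite leqNgt; apply/negP => ll'.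
  have qa : q <= a by have := mem_fst_iota (box_fst B) al; case/andP.
  have l0 : 0 < l by have /allP/(_ _ al) := box_pos B.
  have [R xR zR] := box_perm B; have [R' _ zR'] := box_perm B'.
  have zl : ((a, l'.-1), row_vacancy z a l'.-1) \in rigged z.
    rewrite (perm_mem zR') mem_cat mem_rows_with mem_shrink /= eqxx andbT.
    by rewrite prednK ?al' ?andbT; [apply/orP; right; clear -ll' l0; lia|clear -ll'; lia].
  have hs : hit s' a l'.-1 by apply/hitP; exists l => //; clear -ll'; lia.
  have i0 : 0 < l'.-1 by clear -ll' l0; lia.
  have a0 : 0 < a by apply: leq_trans qa.
  have V := box_vacancy B a0 i0.
  have hp : ((hit s' a.-1 l'.-1)%:Z + (a == q)%:Z = 1)%R.
    have [aq|aq] := eqVneq a q.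
      suff -> : hit s' a.-1 l'.-1 = false by [].
      by apply/negP => /(hit_fst_iota (box_fst B)); clear -aq q0; lia.
    by rewrite (box_chain B _ hs)//; clear -qa aq; lia.
  have zx : (row_vacancy z a l'.-1 <= row_vacancy x' a l'.-1)%R.
    move: zl; rewrite (perm_mem zR) mem_cat => /orP[zl|].
      have := let: And4 _ _ _ h := xRC in h ((a, l'.-1), row_vacancy z a l'.-1).
      by rewrite (perm_mem xR) mem_cat zl => /(_ isT)/andP[].
    rewrite mem_rows_with mem_shrink /= => /andP[/andP[_]]; rewrite prednK; last first.
      by clear -ll'; lia.
    by move=> al2; have := hit_uniq l (box_fst B) al2; rewrite (hit_uniq _ (box_fst B) al) leqnn leqNgt ll'.
  (* At this length the vacancy number of [z] exceeds that of [x'] by 1, less 1 if the next colour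
     is hit; the bound [zx] forces that hit. Carried over to [t'] and chained down to colour a, it
     contradicts the selected length l'. *)
  have hs1 : hit s' a.+1 l'.-1.
    have qa1 : (a == q.-1) = false by apply/eqP; clear -qa q0; lia.
    by move: zx hp; rewrite V hs qa1; case: (hit s' a.+1 _) => //; clear; lia.
  have := box_chain B' (qa : q < a.+1) (hst _ hs1).
  by rewrite (hit_uniq _ (box_fst B') al') /=; clear -ll'; lia.
move=> Bx By xRC yRC xy st.
have sE : s = t.
  have ss := box_fst Bx; have tt := box_fst By.
  suff H a : hit s a =1 hit t a by apply: (hit_inj ss tt) => a; apply: H.
  have [d] := ubnP (q + size s - a); elim: d a => // d IHd a ad i.
  case: (boolP (q <= a < q + size s)) => [aqs|naqs]; last first.
    rewrite (negbTE (contra (hit_fst_iota ss (a := a) (i := i)) naqs)).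
    by rewrite st in naqs; rewrite (negbTE (contra (hit_fst_iota tt (a := a) (i := i)) naqs)).
  have IH : hit s a.+1 =1 hit t a.+1.
    by apply: IHd; move: ad aqs; clear; lia.
  have /mapP[[a1 l] al /= E1] : a \in map fst s by rewrite ss mem_iota.
  have /mapP[[a2 l'] al' /= E2] : a \in map fst t by rewrite tt -st mem_iota.
  subst a1 a2; rewrite (hit_uniq i ss al) (hit_uniq i tt al').
  have l'l : l' <= l.
    by apply: (half _ _ _ _ _ _ _ _ Bx By xRC _ al al') => j; rewrite IH.
  have ll' : l <= l'.
    by apply: (half _ _ _ _ _ _ _ _ By Bx yRC _ al' al) => j; rewrite IH.
  by have -> // : l = l'; apply/eqP; rewrite eqn_leq ll'.
subst t; apply: rigged_configuration_eq => //.
have [R xR zR] := box_perm Bx; have [R' yR zR'] := box_perm By.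
rewrite -[LHS]seq_mset_id -[RHS]seq_mset_id.
apply/eq_seq_msetP; rewrite (permPl xR) (permPr yR).
have -> : rows_with (row_vacancy x) s = rows_with (row_vacancy y) s.
  apply: eq_rows_with => -[a l] al /=.
  have qa : q <= a by have := mem_fst_iota (box_fst Bx) al; case/andP.
  have l0 : 0 < l by have /allP/(_ _ al) := box_pos Bx.
  have a0 : 0 < a := leq_trans q0 qa.
  have := box_vacancy Bx a0 l0; rewrite (box_vacancy By a0 l0); clear; lia.
rewrite perm_cat2r -(perm_cat2r (rows_with (row_vacancy z) (shrink s))).
by rewrite -(permPl zR).
Qed.

(** Nesting makes the sizes of the selections weakly increase with the stage. Hence the ranks j +
    |sel j| strictly increase down the column, and the bound n + 1 at the bottom propagates
    upwards. *)
Lemma column_selection_size n r k x z sel j : column_removal n r k x z sel ->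
  0 < j <= r -> j + size (sel j) <= n.+1 - (r - j).
Proof.
move=> C; have [d] := ubnP (r - j); elim: d j => // d IHd j rd jr.
have [jr'|jr'] := eqVneq j r; first by have := column_size C jr; rewrite jr' subnn; lia.
have jr1 : 0 < j.+1 <= r by clear -jr jr'; lia.
have := IHd j.+1 (_ : _ < d) jr1; have -> : r - j.+1 < d by clear -rd jr1; lia.
move=> /(_ isT); suff : size (sel j) <= size (sel j.+1) by clear -jr1; lia.
have [->//|s0] := posnP (size (sel j)).
have /mapP[[a l] al /= aE] : j + (size (sel j)).-1 \in map fst (sel j).
  by rewrite (column_fst C jr) mem_iota; clear -s0; lia.
have hal : hit (sel j) a l by apply/hitP; exists l.
have := column_nest C jr hal; rewrite /column_hit eqSS (negPf jr').
move=> /(hit_fst_iota (column_fst C jr1)).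
by clear -s0 aE; lia.
Qed.

(** The rows shortened by the first removal are singular in [z] and at least k - 1 long, so they are
    candidates for the second removal, which reaches at least as far. *)
Lemma row_selection_size n k x z w s s' : 1 < k ->
  column_removal n 1 k x z s -> column_removal n 1 k.-1 z w s' ->
  size (s 1) <= size (s' 1).
Proof.
move=> k1 C C'; have j1 : 0 < 1 <= 1 by [].
have hits a l : (a, l) \in s 1 -> hit (s' 1) a l.-1.
  have [d] := ubnP a; elim: d a l => // d IHd a l ad al.
  have kl : k <= l.
    have hal : hit (s 1) a l by apply/hitP; exists l.
    by have := column_nest C j1 hal.
  have a0 : 0 < a by have := mem_fst_iota (column_fst C j1) al; case/andP.
  have [U [_ zU _]] := column_perm C; have [U' [zU' _ hitU']] := column_perm C'.
  have : ((a, l.-1), row_vacancy z a l.-1) \in rigged z.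
    rewrite (perm_mem zU) mem_cat mem_rows_with mem_shrink /= eqxx andbT.
    rewrite /selected /= cats0 prednK ?al ?andbT; last by clear -k1 kl; lia.
    by apply/orP; right; clear -k1 kl; lia.
  rewrite (perm_mem zU') mem_cat => /orP[inU|]; last first.
    rewrite mem_rows_with /selected /= cats0 => /andP[al' _].
    by apply/hitP; exists l.-1.
  apply: (hitU' _ _ _ inU j1 a0); first by rewrite /column_hit /=; clear -kl; lia.
  have [//|a1] := eqVneq a 1; have a1' : 1 < a by clear -a0 a1; lia.
  have /hitP[l' al' l'l] : hit (s 1) a.-1 l.
    by apply: (column_chain C j1 a1'); apply/hitP; exists l.
  have ad' : a.-1 < d by clear -ad a1'; lia.
  by have := IHd a.-1 l' ad' al'; apply: hit_le; clear -l'l; lia.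
have [->//|s0] := posnP (size (s 1)).
have /mapP[[a l] al /= aE] : size (s 1) \in map fst (s 1).
  by rewrite (column_fst C j1) mem_iota; clear -s0; lia.
have := hit_fst_iota (column_fst C' j1) (hits _ _ al).
by rewrite -aE; clear; lia.
Qed.

Section Rows.

Variables (n : nat) (Phi : crystal -> seq tableau -> rigged_configuration).
Hypothesis KSS : is_KSS_bijection n Phi.

(* Removing a row of letters from the left gives weakly increasing ranks. If the
   first rank is not 1, no rank is, and the row is a horizontal strip that
   avoids the first row of the weight, which bounds its length. *)
Definition row_state B b t j := column_state Phi B 1 (size t) [:: t] b j.
Definition row_selection B b t := column_selection n Phi B 1 (size t) [:: t] b 1.

(** If [gap] is read as the difference of consecutive parts of a weight, the sum on the right
    telescopes to part c minus part n + 1. The term at c on the left strengthens the induction: a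
    box of the same rank c consumes one unit of it, and a box of smaller rank opens a gap not yet
    touched. *)
Lemma row_strip B b t (c := size (row_selection B b t)) :
  wf_crystal n ((1, size t) :: B) -> paths n ((1, size t) :: B) ([:: t] :: b) ->
  0 < c ->
  (forall a, 0 < a < c -> gap (row_state B b t 1) a = gap (Phi B b) a) /\
  ((size t)%:Z + gap (row_state B b t 1) c
     <= \sum_(c <= a < n.+1) gap (Phi B b) a)%R.
Proof.
rewrite {}/c; elim: t => [|c0 t IHt] wB pb; first by move: wB; rewrite /= /wf_factor andbF.
set s := row_selection _ _ _; set y := row_state _ _ _ => c_gt0.
have [wB0 pb0] : wf_crystal n B /\ paths n B b.
  by split; [case/andP: wB|exact: paths_behead pb].
have xRC := KSS_RC KSS wB0 pb0; set x := Phi B b in xRC IHt *.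
have Bx : box_removal n 1 (y 1) (y 0) s := column_boxes KSS wB pb (isT : 0 < 1 <= 1).
have cn : size s <= n by have := box_size Bx.
have gapy a : 0 < a -> (gap (y 1%N) a = gap (y 0%N) a + (a == (size s).+1)%:Z
    - (a == size s)%:Z)%R.
  by move=> a0; rewrite (gap_box _ Bx)// add1n eqSS.
have sum_ge0 p q : 0 < p -> q <= n.+1 -> (0 <= \sum_(p <= a < q) gap x a)%R.
  move=> p0 qn; rewrite big_nat_cond sumr_ge0// => a /andP[/andP[pa aq] _].
  by apply: (gap_ge0 xRC); rewrite (leq_trans p0 pa) -ltnS (leq_trans aq).
case: t => [|c1 t] in s y IHt wB pb c_gt0 Bx cn gapy *.
  have yx : y 0 = x by [].
  split=> [a ac|].
    by rewrite gapy ?yx; [rewrite !ltn_eqF; clear -ac; lia|clear -ac; lia].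
  rewrite gapy// eqxx ltn_eqF// yx big_ltn//.
  have := sum_ge0 (size s).+1 n.+1 isT (leqnn _); move: (\sum_(_ <= a < _) _)%R => S.
  by rewrite /=; clear; lia.
have k1 : 1 < size [:: c0, c1 & t] by [].
have [wB1 pb1] := column_rest KSS wB pb.
have C := column_removal_KSS KSS wB pb.
have C1 := column_removal_KSS KSS wB1 pb1.
pose t' := c1 :: t.
have ss : size s <= size (row_selection B b t') := row_selection_size k1 C C1.
have [ih1 ih2] := IHt wB1 pb1 (leq_trans c_gt0 ss).
have y0 a : 0 < a -> gap (y 0) a = gap (row_state B b t' 1) a.
  move=> a0; apply/esym; apply: (eq_gap (M := size [:: c0, c1 & t])) => i ki.
  rewrite (column_top_vacancy KSS wB1 pb1 a0); last by clear -ki k1; lia.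
  by rewrite [i < _]ltnNge (leq_trans _ ki) ?andbF ?addr0.
have c'n : size (row_selection B b t') <= n.
  by have := column_size C1 (isT : 0 < 1 <= 1).
have [wy py] := column_states KSS wB1 pb1 (leqnn 1).
have yRC := KSS_RC KSS wy py.
move: ih1 ih2 y0 ss c'n; rewrite -/t' -/(row_state B b t' 1).
set c' := size (row_selection B b t'); set y' := row_state B b t' 1.
move=> ih1 ih2 y0 ss c'n; have c'0 : 0 < c' := leq_trans c_gt0 ss.
have gy' : (0 <= gap y' c')%R by apply: (gap_ge0 yRC); rewrite c'0.
split=> [a /andP[a0 ac]|].
  rewrite gapy// y0// ih1 ?a0 ?(leq_trans ac)// !ltn_eqF// ?ltnS 1?ltnW//.
  by clear; lia.
have sz : ((size [:: c0, c1 & t])%:Z = (size t')%:Z + 1)%R by rewrite /=; lia.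
rewrite gapy// eqxx ltn_eqF// y0//.
have [cc'|cc'] := eqVneq c' (size s).
  by move: ih2; rewrite cc' sz; clear; lia.
have lt : size s < c' by rewrite ltn_neqAle eq_sym cc'.
rewrite ih1 ?c_gt0// big_ltn// (big_cat_nat _ (n := c'))//=; last exact: ltnW.
have := sum_ge0 (size s).+1 c' isT (leqW c'n); rewrite sz.
move: ih2 gy'; do 2 move: (\sum_(_ <= a < _) _)%R => ?; clear; lia.
Qed.

Lemma row_strip_total B b t : wf_crystal n ((1, size t) :: B) ->
  paths n ((1, size t) :: B) ([:: t] :: b) -> 0 < size (row_selection B b t) ->
  ((size t)%:Z <= \sum_(1 <= a < n.+1) gap (Phi B b) a)%R.
Proof.
move=> wB pb c0; have [_ le] := row_strip wB pb c0.
have [wy py] := column_states KSS wB pb (leqnn 1).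
have yRC := KSS_RC KSS wy py.
have cn : size (row_selection B b t) <= n.
  by have := column_size (column_removal_KSS KSS wB pb) (isT : 0 < 1 <= 1).
have [wB0 pb0] : wf_crystal n B /\ paths n B b.
  by split; [case/andP: wB|exact: paths_behead pb].
have xRC := KSS_RC KSS wB0 pb0.
have : (0 <= gap (row_state B b t 1) (size (row_selection B b t)))%R.
  by apply: (gap_ge0 yRC); rewrite c0.
rewrite (big_cat_nat _ (n := size (row_selection B b t)))//=; last exact: leqW.
have : (0 <= \sum_(1 <= a < size (row_selection B b t)) gap (Phi B b) a)%R.
  rewrite big_nat_cond sumr_ge0// => a /andP[/andP[a0 ac] _].
  by apply: (gap_ge0 xRC); rewrite a0 (leq_trans (ltnW ac)).
move: le; do 2 move: (\sum_(_ <= a < _) _)%R => ?.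
clear; lia.
Qed.

End Rows.

(** * The letter of a box and its rank *)

Lemma column_word s : tableau_word [seq [:: c] | c <- s] = rev s.
Proof.
elim: s => //= c s IHs; rewrite tableau_word_cons IHs.
by rewrite rev_cons cats1.
Qed.

Lemma lattice_box i d w : lattice i w ->
  (d = i.+1 -> count_mem i.+1 w < count_mem i w) -> lattice i (d :: w).
Proof.
move=> lw dw; apply/lattice_cons; split=> //=.
have := lw 0; rewrite drop0; have [di|_] := eqVneq d i.+1; last first.
  by move=> h; rewrite (leq_trans h) ?leq_addl.
by rewrite di (gtn_eqF (ltnSn i)) => _; apply: dw.
Qed.

(** Each letter i + 1 beyond the first box d is preceded, in reading from the right, by a letter i
    of the same column. *)
Lemma lattice_iota i d m w : lattice i (d :: w) ->
  lattice i (rev (iota d m.+1) ++ w).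
Proof.
move=> dw; elim: m => [//|m IHm].
have -> : iota d m.+2 = rcons (iota d m.+1) (d + m.+1).
  by rewrite -[m.+2]addn1 iotaD cats1.
rewrite rev_rcons; apply: lattice_box => // dmi.
have c1 : count_mem i (iota d m.+1) = 1.
  rewrite count_uniq_mem ?iota_uniq// mem_iota.
  by have -> : d <= i < d + m.+1 by clear -dmi; lia.
have c2 : count_mem i.+1 (iota d m.+1) = 0.
  by apply/count_memPn; rewrite mem_iota -dmi ltnn andbF.
have cr c : count_mem c (rev (iota d m.+1)) = count_mem c (iota d m.+1).
  by apply/permP; rewrite perm_rev.
rewrite !count_cat !cr c1 c2; have /lattice_cons[lw _] := dw.
by have := lw 0; rewrite drop0.
Qed.

Lemma count_flatten_nseq (h : nat -> nat) s c : uniq s ->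
  count_mem c (flatten [seq nseq (h a) a | a <- s]) = (c \in s) * h c.
Proof.
elim: s => //= a s IHs /andP[as_ us]; rewrite count_cat count_nseq IHs// in_cons.
rewrite /= [a == c]eq_sym; case: eqVneq => [->|_]; last by rewrite mul0n.
by rewrite (negPf as_) mul0n addn0.
Qed.

Lemma sorted_flatten_nseq (h : nat -> nat) s : sorted leq s ->
  sorted leq (flatten [seq nseq (h a) a | a <- s]).
Proof.
rewrite !(sorted_pairwise leq_trans); elim: s => //= a s IHs /andP[/allP as_ ps].
rewrite pairwise_cat IHs// andbT; apply/andP; split.
  apply/allrelP => _ c /nseqP[-> _] /flatten_mapP[e es /nseqP[-> _]]; exact: as_.
by elim: (h a) => //= k ->; rewrite andbT; apply/allP => _ /nseqP[->].
Qed.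

Lemma size_flatten_nseq (h : nat -> nat) s :
  size (flatten [seq nseq (h a) a | a <- s]) = \sum_(a <- s) h a.
Proof.
by rewrite size_flatten sumnE big_map big_map; apply: eq_bigr => a _; rewrite size_nseq.
Qed.

Lemma is_tableau_row n w : sorted leq w -> {in w, forall c, 1 <= c <= n.+1} ->
  is_tableau n (1, size w) [:: w].
Proof. by move=> sw lw; apply/tableauP; split=> // _ /predU1P[->|//]. Qed.

Lemma sum_indicator (n p : nat) :
  (\sum_(1 <= a < n.+1) (a == p)%:Z = (0 < p <= n)%N%:Z)%R.
Proof.
elim: n => [|n IHn]; first by rewrite big_geq//; case: p.
by rewrite big_nat_recr//= IHn; case: eqVneq => *; lia.
Qed.

Section Box.

Variables (n : nat) (Phi : crystal -> seq tableau -> rigged_configuration).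
Hypothesis KSS : is_KSS_bijection n Phi.

Variables (B : crystal) (b : seq tableau).
Hypotheses (n0 : 0 < n) (wB : wf_crystal n B) (pb : paths n B b).
Hypothesis weightb : forall a, 0 < a <= n ->
  (gap (Phi B b) a = (count_mem a (row_word b))%:Z - (count_mem a.+1 (row_word b))%:Z)%R.

Let boxed d := Phi ((1, 1) :: B) ([:: [:: d]] :: b).
Let rank d := size (box_selection n 1 (boxed d)).
Let box_path d := paths n ((1, 1) :: B) ([:: [:: d]] :: b).

Let wB1 : wf_crystal n ((1, 1) :: B).
Proof. by rewrite /= wB /wf_factor /= n0. Qed.

Let box_removal_boxed d : box_path d ->
  box_removal n 1 (boxed d) (Phi B b) (box_selection n 1 (boxed d)).
Proof.
move=> pd.
by have [] := @KSS_partial n Phi KSS B [:: [:: d]] b 0 wB1 isT pd.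
Qed.

Let box_pathP d : 1 <= d <= n.+1 ->
  (1 < d -> count_mem d (row_word b) < count_mem d.-1 (row_word b)) -> box_path d.
Proof.
have [tb /highest_weightP hw] := pb => dn hd; apply/paths_cons; split=> //.
  apply/tableauP; split=> // _ /predU1P[->|//]; split=> // c.
  by move=> /predU1P[->|//].
apply/highest_weightP => i i_n; apply: lattice_box; first exact: hw.
by move=> di; move: hd; rewrite di; apply; case: (i) i_n.
Qed.

Let box_path_letter d : box_path d -> 1 <= d <= n.+1.
Proof.
move=> /paths_cons[/tableauP[_ h _] _ _].
by have [_ _ /(_ d (mem_head _ _))] := h _ (mem_head _ _).
Qed.

Let boxed_RC d : box_path d -> RC n (crystal_mult ((1, 1) :: B)) (boxed d).
Proof. exact: KSS_RC. Qed.

Let rank_inj d e : box_path d -> box_path e -> rank d = rank e -> d = e.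
Proof.
move=> pd pe de; have Bd := box_removal_boxed pd; have Be := box_removal_boxed pe.
suff : boxed d = boxed e by move=> /(KSS_inj KSS wB1 pd pe)[].
apply: (box_removal_inj _ Bd Be (boxed_RC pd) (boxed_RC pe)) => //.
by rewrite !(KSS_mult KSS).
Qed.

Let gap_boxed d a : box_path d -> 0 < a ->
  (gap (boxed d) a = gap (Phi B b) a + (a == (rank d).+1)%:Z - (a == rank d)%:Z)%R.
Proof. by move=> pd a0; rewrite (gap_box _ (box_removal_boxed pd))// add1n eqSS. Qed.

(* Above a box [d] one can complete the column [d, d + 1, ..., n + 1], whose
   removal selects a strictly increasing sequence of ranks. *)
Let rank_le d : 1 < d -> box_path d -> rank d < d.
Proof.
move=> d1 pd; have /andP[_ dn] := box_path_letter pd.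
pose m := n.+1 - d; pose T := [seq [:: c] | c <- iota d m.+1].
have wB' : wf_crystal n ((m.+1, 1) :: B).
  by rewrite /= wB /wf_factor /= !andbT; rewrite /m; clear -d1 dn; lia.
have pT : paths n ((m.+1, 1) :: B) (T :: b).
  have [_ _ /highest_weightP hd] := (paths_cons _ _ _ _ _).1 pd.
  have [tb _] := pb.
  apply/paths_cons; split=> //.
    apply/tableauP; split; first by rewrite size_map size_iota.
      move=> _ /mapP[c + ->]; rewrite mem_iota => cm; split=> // c'.
      by move=> /predU1P[->|//]; move: cm; rewrite /m; clear -d1 dn; lia.
    rewrite sorted_map; apply: sub_sorted (iota_ltn_sorted d m.+1) => c c' /=.
    by rewrite andbT.
  apply/highest_weightP => i i_n; rewrite row_word_cons column_word.
  exact: lattice_iota (hd i i_n).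
have C := column_removal_KSS KSS wB' pT.
have := column_selection_size C (isT : 0 < 1 <= m.+1).
rewrite /column_selection /column_state /= take0.
by rewrite -/(boxed d) -/(rank d) /m; clear -dn; lia.
Qed.

(* If [1] had rank [c + 1 > 1], then the longest horizontal strip [u] over
   [1 :: row_word b] without letters 1, and [1 :: behead u], would both have
   first rank 1, by [row_strip_total]; but they have the same remainder. *)
Let rank1 : rank 1 = 0.
Proof.
have p1 : box_path 1 by apply: box_pathP.
have [//|c0] := posnP (rank 1).
pose B1 := (1, 1) :: B; pose b1 := [:: [:: 1]] :: b.
pose w1 := 1 :: row_word b.
have hw1 i : 0 < i <= n -> lattice i w1.
  by have [_ _ /highest_weightP] := (paths_cons _ _ _ _ _).1 p1; apply.
pose h e := count_mem e.-1 w1 - count_mem e w1.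
have hE i : 0 < i <= n -> h i.+1 + count_mem i.+1 w1 = count_mem i w1.
  by move=> i_n; have := hw1 i i_n 0; rewrite drop0 /h; apply: subnK.
pose row_path t := paths n ((1, size t) :: B1) ([:: t] :: b1).
have row_pathP t : sorted leq t -> {in t, forall c, 1 <= c <= n.+1} ->
    (forall i, 0 < i <= n -> count_mem i.+1 t <= h i.+1) -> row_path t.
  move=> st lt ht; apply/paths_cons; split; first exact: is_tableau_row.
    by case: p1.
  apply/highest_weightP => i i_n; rewrite row_word_cons /tableau_word /= cats0.
  apply/(lattice_row _ _ st); split; first exact: hw1.
  by rewrite -[X in _ <= X](hE i i_n) leq_add2r ht.
pose u := flatten [seq nseq (h e) e | e <- iota 2 n].
have su : sorted leq u.
  by apply/sorted_flatten_nseq/sub_sorted/iota_ltn_sorted => i j /ltnW.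
have lu c : c \in u -> 2 <= c <= n.+1.
  by move=> /flatten_mapP[e + /nseqP[-> _]]; rewrite mem_iota; lia.
have cu i : 0 < i <= n -> count_mem i.+1 u <= h i.+1.
  by move=> _; rewrite count_flatten_nseq ?iota_uniq//; case: (_ \in _); lia.
(* The numbers [h e] telescope; the additional 1 comes from the box 1 in [w1]. *)
have sizeu : ((size u)%:Z = \sum_(1 <= a < n.+1) gap (Phi B b) a + 1)%R.
  suff IH m : m <= n -> ((\sum_(a <- iota 2 m) h a)%N%:Z =
      \sum_(1 <= a < m.+1) gap (Phi B b) a + (0 < m)%N%:Z)%R.
    by rewrite size_flatten_nseq IH// n0.
  elim: m => [|m IHm] mn; first by rewrite big_nil big_geq.
  have -> : iota 2 m.+1 = rcons (iota 2 m) m.+2.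
    by rewrite -cats1 -{1}(addn1 m) iotaD.
  rewrite -cats1 big_cat big_seq1 PoszD IHm; last exact: ltnW.
  rewrite [in RHS]big_nat_recr//= weightb//; have := hE m.+1 mn.
  rewrite /w1 /= eqSS; move: (count_mem m.+1 _) (count_mem m.+2 _) (h m.+2).
  by move: (\sum_(_ <= a < _) _)%R; clear; case: m => [|m] /=; lia.
have : 0 < size u.
  have : (0 <= \sum_(1 <= a < n.+1) gap (Phi B b) a)%R.
    rewrite big_nat_cond sumr_ge0// => a /andP[an _].
    exact: gap_ge0 (KSS_RC KSS wB pb) an.
  by rewrite -ltz_nat sizeu; lia.
case: u su lu cu sizeu => // c v su lu cu sizeu _.
have sizeu' : (((size v).+1)%:Z = \sum_(1 <= a < n.+1) gap (Phi B b) a + 1)%R.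
  by [].
have wrow : wf_crystal n ((1, (size v).+1) :: B1).
  by rewrite /B1 /wf_crystal /= -/(wf_crystal n _) wB /wf_factor /= n0.
have pu : row_path (c :: v).
  by apply: row_pathP => // e /lu; case/andP=> /ltnW -> ->.
have p1v : row_path (1 :: v).
  have /lu/andP[c1 _] := mem_head c v.
  apply: row_pathP => [|e|i i_n].
  - rewrite /= path_min_sorted ?(path_sorted su)//; apply/allP => e ev.
    by have /lu/andP[/ltnW] : e \in c :: v by apply: (@mem_behead _ (c :: v)).
  - move=> /predU1P[->//|ev].
    by have /lu/andP[/ltnW -> ->] : e \in c :: v by apply: (@mem_behead _ (c :: v)).
  - by apply: leq_trans (cu i i_n) => /=; case/andP: i_n => i0 _; case: (i) i0 => //= *; lia.
have r0 t : size t = (size v).+1 -> row_path t -> size (row_selection n Phi B1 b1 t) = 0.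
  move=> tv pt; apply/eqP; rewrite -leqn0 leqNgt; apply/negP => c1.
  have wt : wf_crystal n ((1, size t) :: B1) by rewrite tv.
  have := row_strip_total KSS wt pt c1.
  rewrite tv sizeu' leNgt => /negP; apply.
  (* If the rank c of the box 1 is positive, adding this box changes the total of the gaps by -1,
     plus 1 if c < n. The total therefore stays below the length of the row. *)
  have -> : (\sum_(1 <= a < n.+1) gap (Phi B1 b1) a = \sum_(1 <= a < n.+1)
      (gap (Phi B b) a + ((a == (rank 1).+1)%:Z - (a == rank 1)%:Z)))%R.
    by apply: eq_big_nat => a /andP[a0 _]; rewrite addrA gap_boxed.
  rewrite big_split /= ltrD2l [ltLHS]sumrB !sum_indicator.
  have := box_size (box_removal_boxed p1); rewrite -/(rank 1); lia.
have [wy py] := column_states KSS wrow pu (leqnn 1).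
have [_ pz] := column_states KSS wrow p1v (leqnn 1).
have By := column_boxes KSS wrow pu (isT : 0 < 1 <= 1).
have Bz := column_boxes KSS wrow p1v (isT : 0 < 1 <= 1).
have yz := box_removal_inj (isT : 0 < 1) By Bz (KSS_RC KSS wy py) (KSS_RC KSS wy pz).
have sE : size (column_selection n Phi B1 1 (size v).+1 [:: c :: v] b1 1) =
    size (column_selection n Phi B1 1 (size v).+1 [:: 1 :: v] b1 1).
  by rewrite [LHS](r0 (c :: v))// [RHS](r0 (1 :: v)).
have mE : mult (column_state Phi B1 1 (size v).+1 [:: c :: v] b1 1) =
    mult (column_state Phi B1 1 (size v).+1 [:: 1 :: v] b1 1).
  by rewrite /column_state !(KSS_mult KSS wy).
have /= := KSS_inj KSS wy py pz (yz mE sE); rewrite !take0 => -[c1].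
by have := lu c (mem_head _ _); rewrite c1.
Qed.

(** If the rank of d were smaller than d - 1, the letter e = rank d + 1 could be added as well,
    because the gap of [boxed d] at rank d is nonnegative. By induction e has the same rank as d,
    against [rank_inj]. *)
Let rankE d : box_path d -> rank d = d.-1.
Proof.
elim/ltn_ind: d => d IHd pd; have /andP[d0 dn] := box_path_letter pd.
have [d1|d1] := leqP d 1; first by have -> : d = 1 by [lia]; exact: rank1.
have rd := rank_le d1 pd.
have [//|ne] := eqVneq (rank d) d.-1.
have ed : (rank d).+1 < d by clear -rd ne; lia.
have pe : box_path (rank d).+1.
  apply: box_pathP; first by clear -ed dn; lia.
  rewrite ltnS /= => r0; have rn : 0 < rank d <= n by clear -ed dn r0; lia.
  have := gap_ge0 (boxed_RC pd) rn; rewrite gap_boxed// weightb//.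
  rewrite eqxx ltn_eqF//.
  by move: (count_mem (rank d) _) (count_mem (rank d).+1 _); clear; lia.
have := IHd _ ed pe; move=> re.
by move: ed; rewrite -(rank_inj pd pe (esym re)) ltnn.
Qed.

Lemma gap_box_weight d : box_path d -> forall a, 0 < a <= n ->
  (gap (boxed d) a = (count_mem a (d :: row_word b))%:Z
    - (count_mem a.+1 (d :: row_word b))%:Z)%R.
Proof.
move=> pd a an; have /andP[d0 _] := box_path_letter pd.
rewrite gap_boxed//; last by case/andP: an.
by rewrite weightb// rankE// prednK//= !(eq_sym d); clear -d0; lia.
Qed.

End Box.

(** [lb] and [ls] preserve the number of boxes. The squares make every splitting of a factor
    decrease this measure. *)
Definition crystal_size (B : crystal) := \sum_(q <- B) (q.1 * q.2) ^ 2.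

Lemma gap_empty a : gap (RiggedConfiguration mset0 mset0) a = 0%R.
Proof.
have c0 : config mset0 = mset0.
  by apply/msetP => q; rewrite /config enum_mset0 mset_seqE mset0E.
by rewrite /gap /= c0 !enum_mset0 !big_nil.
Qed.

Lemma gap_unboxed q x L a : 0 < q -> mult x = seq_mset ((q, 1) :: L) -> 0 < a ->
  gap (unboxed q x) a = gap x a.
Proof.
move=> q0 mx a0; apply: (eq_gap (M := 1)) => i i0.
exact: (vacancy_unboxed q0 (leqnn q) mx a0 i0).
Qed.

Lemma gap_weight n Phi B b : 0 < n -> is_KSS_bijection n Phi ->
  wf_crystal n B -> paths n B b -> forall a, 0 < a <= n ->
  (gap (Phi B b) a
   = (count_mem a (row_word b))%:Z - (count_mem a.+1 (row_word b))%:Z)%R.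
Proof.
move=> n0 KSS; have [d] := ubnP (crystal_size B).
elim: d B b => // d IHd [|[r s] B] [|T b] Bd wB pb a an; try by case: pb.
  by rewrite (KSS_empty KSS) gap_empty.
have a0 : 0 < a by case/andP: an.
have [tT tb hw] := (paths_cons _ _ _ _ _).1 pb.
have /andP[/andP[/= /andP[r0 rn] s0] wB0] := wB.
have wB' : wf_crystal n B := wB0.
move: Bd; rewrite /crystal_size big_cons /= => Bd.
have [s1|s1] := ltnP 1 s.
  have [neT _] := tableau_heads s0 tT.
  have pls := ls_path s1 pb.
  have wls : wf_crystal n [:: (r, 1), (r, s.-1) & B].
    by rewrite /wf_crystal /= -/(wf_crystal n B) wB' /wf_factor /= r0 rn; clear -s1; lia.
  have -> : gap (Phi ((r, s) :: B) (T :: b)) a =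
      gap (Phi [:: (r, 1), (r, s.-1) & B] (ls (T :: b))) a.
    apply/esym; apply: (eq_gap (M := s)) => i si.
    have := column_top_vacancy KSS wB pb a0 (leq_trans s0 si).
    rewrite [i < s]ltnNge si andbF addr0 /column_state /column_crystal /column_path s1.
    have := size_column pb; case: (r) r0 => // r' _ sT.
    by rewrite /= take_oversize ?sT.
  rewrite (IHd _ _ _ wls pls)//; last first.
    rewrite /crystal_size !big_cons /= -ltnS; apply: leq_trans Bd; rewrite ltnS.
    rewrite addnA ltn_add2r muln1 !expnMn.
    have : 0 < r ^ 2 by rewrite expn_gt0 r0.
    by move: (r ^ 2) s1 => R; case: s {tT pb wB s0 pls wls} => [|[|s]]//= _; nia.
  rewrite !count_ls//; by apply: sub_all neT => w /andP[].
have {s0 s1} s_eq1 : s = 1 by clear -s0 s1; lia.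
subst s; have [r1|r1] := ltnP 1 r.
  case: r r0 r1 {rn} wB pb tT Bd => // r _ r1 wB pb tT Bd.
  have := tT => /tableauP[]; case/lastP: T tT pb {hw} => // T w tT pb _ _ _.
  have plb := lb_path pb.
  have wlb : wf_crystal n [:: (1, 1), (r, 1) & B].
    move: wB => /= /andP[/andP[/andP[_ /= rn] _] _].
    by rewrite /wf_crystal /= -/(wf_crystal n B) wB' /wf_factor /= n0; clear -r1 rn; lia.
  rewrite -(gap_unboxed (ltn0Sn r) (KSS_mult KSS wB pb) a0) /unboxed r1.
  rewrite -(KSS_lb KSS r1 wB pb) (IHd _ _ _ wlb plb)//; last first.
    rewrite /crystal_size !big_cons /= -ltnS; apply: leq_trans Bd; rewrite ltnS.
    by rewrite addnA ltn_add2r !muln1 exp1n; clear -r1; nia.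
  by rewrite row_word_lb.
have r_eq1 : r = 1 by clear -r0 r1; lia.
subst r; have /tableauP[] := tT; case: T tT pb {hw} => [//|u [|//]] tT pb _ sT _.
have [+ _ _] := sT _ (mem_head _ _); case: u tT pb sT => [//|c [|//]] _ pb _ _.
apply: (gap_box_weight KSS n0 wB' (paths_behead pb)) => // e en.
by apply: IHd (paths_behead pb) _ en.
Qed.

(** * Similarity *)

Definition stretch (m : nat) (w : seq nat) := flatten [seq nseq m c | c <- w].

Lemma count_stretch m c w : count_mem c (stretch m w) = m * count_mem c w.
Proof.
elim: w => [|e w IHw]; first by rewrite muln0.
by rewrite /stretch /= count_cat -/(stretch m w) IHw count_nseq mulnDr /= mulnC.
Qed.

Lemma size_stretch m w : size (stretch m w) = m * size w.
Proof.
elim: w => [|e w IHw]; first by rewrite muln0.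
by rewrite /stretch /= size_cat -/(stretch m w) IHw size_nseq mulnS.
Qed.

Lemma stretch_flatten m ss : stretch m (flatten ss) = flatten (map (stretch m) ss).
Proof.
by elim: ss => //= w ss IHss; rewrite -IHss /stretch map_cat flatten_cat.
Qed.

Lemma lattice_stretch i m w : lattice i w -> lattice i (stretch m w).
Proof.
elim: w => // c w IHw /lattice_cons[lw cw].
rewrite /stretch /= -/(stretch m w); apply/lattice_row.
  by case: m {IHw} => //= m; elim: m => //= m ->; rewrite leqnn.
split; first exact: IHw.
rewrite !count_stretch count_nseq mulnC -mulnDr leq_mul2l; apply/orP; right.
move: cw => /=; have := lw 0; rewrite drop0.
have [->|_] := eqVneq c i.+1; first by rewrite (gtn_eqF (ltnSn i)).
by rewrite add0n.
Qed.

Lemma row_word_sim m b : row_word (sim_path m b) = stretch m (row_word b).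
Proof.
rewrite /row_word stretch_flatten /sim_path -!map_comp; congr flatten.
apply: eq_map => T; rewrite /tableau_word /= stretch_flatten /sim_tableau.
by rewrite map_rev.
Qed.

Lemma sim_tableauP n m r s T : is_tableau n (r, s) T ->
  is_tableau n (r, m * s) (sim_tableau m T).
Proof.
move=> /tableauP[rT sT cT]; apply/tableauP; split; first by rewrite size_map.
  move=> _ /mapP[w /sT[ws sw lw] ->]; split.
  - by rewrite size_stretch ws.
  - exact: sorted_flatten_nseq (fun _ => m) _ sw.
  - by move=> c /flatten_mapP[e ew /nseqP[-> _]]; apply: lw.
rewrite sorted_map; apply: sub_sorted cT => u v.
elim: u v => [|c u IHu] [|e v] //= /andP[ce /IHu uv].
move: uv => /=; move: (flatten _) (flatten _) => u' v' uv {IHu}.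
by elim: m => //= m ->; rewrite ce.
Qed.

Lemma wf_sim n m B : 0 < m -> wf_crystal n B -> wf_crystal n (sim_crystal m B).
Proof.
move=> m0 wB; rewrite /wf_crystal all_map; apply: sub_all wB => q /=.
by rewrite /wf_factor /= muln_gt0 m0.
Qed.

Lemma paths_sim n m B b : paths n B b -> paths n (sim_crystal m B) (sim_path m b).
Proof.
move=> [tb /highest_weightP hw]; split.
  elim: B b tb {hw} => [|[r s] B IHB] [|T b] //= /andP[/(sim_tableauP m) -> /IHB].
  by [].
apply/highest_weightP => i i_n; rewrite row_word_sim; apply: lattice_stretch.
exact: hw.
Qed.

Lemma gap_sim m x a : 0 < m -> gap (sim_RC m x) a = (gap x a *+ m)%R.
Proof.
move=> m0; have [M E] := row_vacancy_gap x; have [M' E'] := row_vacancy_gap (sim_RC m x).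
rewrite -(E a (M + M')) ?leq_addr// -sim_RC_vacancyM E'//.
by rewrite (leq_trans (leq_addl M M'))// leq_pmull.
Qed.

(** * Reconstructing a path from its last columns and its content *)

Lemma size_row_word n B b : all2 (is_tableau n) B b ->
  size (row_word b) = \sum_(q <- B) q.1 * q.2.
Proof.
elim: B b => [|[r s] B IHB] [|T b] //=; first by rewrite big_nil.
move=> /andP[/tableauP[rT sT _] /IHB]; rewrite big_cons row_word_cons size_cat => ->.
congr (_ + _); rewrite /tableau_word size_flatten /shape map_rev sumn_rev -rT.
elim: T {rT} sT => //= w T IHT sT; rewrite IHT; last by move=> u uT; apply: sT; rewrite inE uT orbT.
by have [-> _ _] := sT w (mem_head _ _); rewrite mulSn.
Qed.

Lemma row_word_letters n B b c : all2 (is_tableau n) B b -> c \in row_word b ->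
  1 <= c <= n.+1.
Proof.
elim: B b => [|[r s] B IHB] [|T b] //= /andP[/tableauP[_ sT _] /IHB h].
rewrite row_word_cons mem_cat => /orP[|//]; rewrite /tableau_word.
by move=> /flattenP[w]; rewrite mem_rev => /sT[_ _ +] => /[apply].
Qed.

Lemma sum_count_letters n (w : seq nat) : {in w, forall c, 1 <= c <= n.+1} ->
  \sum_(1 <= c < n.+2) count_mem c w = size w.
Proof.
elim: w => [_|e w IHw lw]; first by rewrite big1.
rewrite /= big_split /= IHw; last by move=> c cw; apply: lw; rewrite inE cw orbT.
rewrite -[RHS]add1n; congr (_ + _).
have ein : e \in index_iota 1 n.+2 by rewrite mem_index_iota ltnS lw ?mem_head.
rewrite (big_rem e ein) eqxx big1_seq ?addn0// => c /andP[_ cin].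
apply/eqP; rewrite eqb0; apply: contraTneq cin => <-.
by rewrite mem_rem_uniqF ?iota_uniq.
Qed.

(** The consecutive differences determine the counts up to a common shift [D 1]. Summing over all n
    + 1 letters and comparing lengths gives (n + 1) [D 1] = 0. *)
Lemma eq_counts n (u v : seq nat) m : size u = m * size v ->
  {in u, forall c, 1 <= c <= n.+1} -> {in v, forall c, 1 <= c <= n.+1} ->
  (forall a, 0 < a <= n -> ((count_mem a u)%:Z - (count_mem a.+1 u)%:Z
     = ((count_mem a v)%:Z - (count_mem a.+1 v)%:Z) *+ m)%R) ->
  forall c, count_mem c u = m * count_mem c v.
Proof.
move=> suv lu lv E.
pose D c : int := ((count_mem c u)%:Z - (m * count_mem c v)%N%:Z)%R.
have DE a : 0 < a <= n -> D a.+1 = D a.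
  move=> an; have := E a an; rewrite -mulr_natl natz /D !PoszM mulrBr; lia.
have D1 a : a <= n -> D a.+1 = D 1.
  elim: a => // a IHa an; rewrite DE// IHa//; exact: ltnW.
have S : (\sum_(1 <= c < n.+2) D c = 0)%R.
  rewrite sumrB -!(big_morph Posz PoszD (erefl _)) -big_distrr /=.
  by rewrite !sum_count_letters// suv subrr.
have D0 : D 1 = 0%R.
  move: S; rewrite (eq_big_nat _ _ (F2 := fun _ => D 1)); last first.
    by case=> // a; rewrite ltnS => /andP[_ an]; rewrite D1.
  rewrite sumr_const_nat -mulr_natl => /eqP; rewrite mulf_eq0 => /orP[|/eqP//].
  by rewrite subSS subn0 natz.
move=> c; case: (boolP (1 <= c <= n.+1)) => [|cn].
  case: c => // c /= cn; have /eqP := D1 c cn.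
  by rewrite D0 subr_eq0 eqz_nat => /eqP.
have cu : c \notin u by apply: contra cn; apply: lu.
have cv : c \notin v by apply: contra cn; apply: lv.
by rewrite (count_memPn cu) (count_memPn cv) muln0.
Qed.

Lemma all2_ltn_nth u v p : all2 ltn u v -> p < size u -> nth 0 u p < nth 0 v p.
Proof.
elim: u v p => [//|c u IHu] [|e v] // [|p] /= /andP[ce uv] //.
exact: IHu.
Qed.

(** A strictly increasing column with letters in [col] and the same height as [col] must exhaust
    [col]. *)
Lemma full_columns m (T : tableau) (col : seq nat) : size T = size col ->
  sorted ltn col -> {in T, forall w, size w = m} ->
  sorted (fun u v => all2 ltn u v) T -> {subset flatten T <= col} ->
  T = map (nseq m) col.
Proof.
move=> sT scol rT cT subT.
have colE p : p < m -> map (fun w => nth 0 w p) T = col.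
  move=> pm; set tp := map _ _.
  have stp : sorted ltn tp.
    rewrite sorted_map; apply: (sub_in_sorted (P := [pred w | size w == m])) cT.
      by move=> u v /eqP um /eqP vm /all2_ltn_nth; apply; rewrite um.
    by apply/allP => w /rT wm; rewrite inE wm.
  apply: (irr_sorted_eq ltn_trans ltnn) => //.
  have utp := sorted_uniq ltn_trans ltnn stp.
  have stpc : {subset tp <= col}.
    move=> _ /mapP[w wT ->]; apply: subT; apply/flattenP; exists w => //.
    by rewrite mem_nth// (rT w wT).
  by have [] := uniq_min_size utp stpc; rewrite size_map sT.
apply: (@eq_from_nth _ [::]) => [|i iT]; first by rewrite size_map.
rewrite (nth_map 0); last by rewrite -sT.
apply: (@eq_from_nth _ 0); first by rewrite size_nseq rT// mem_nth.
move=> p; rewrite (rT _ (mem_nth _ iT)) => pm; rewrite nth_nseq pm.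
by rewrite -(colE p pm) (nth_map [::]).
Qed.

(** Here N counts the columns that remain, whereas k in [column_crystal] counts them before a
    removal. *)
Definition columns_crystal (B : crystal) (r N : nat) : crystal :=
  if 0 < N then (r, N) :: B else B.

Definition columns_path (N t : nat) (T : tableau) (b : seq tableau) :=
  if 0 < N - t then map (drop t) T :: b else b.

Lemma nonempty_rows_id n B : wf_crystal n B -> nonempty_rows B = B.
Proof. by move=> wB; apply/all_filterP; apply: sub_all wB => q /andP[]. Qed.

Lemma nonempty_rows_columns n B r N : wf_crystal n B ->
  nonempty_rows ((r, N) :: B) = columns_crystal B r N.
Proof.
by move=> /nonempty_rows_id BE; rewrite /nonempty_rows /= -/(nonempty_rows B) BE.
Qed.

Lemma column_crystalE B r k : column_crystal B r k = columns_crystal B r k.-1.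
Proof. by case: k => [|[]]. Qed.

(** Any sequence of column removals starting at the image of a path is the one that [Phi] performs:
    at each step source and multiplicity array agree, and [column_removal_uniq] identifies the
    targets. *)
Lemma KSS_columns n Phi B r N T b X m : is_KSS_bijection n Phi ->
  wf_crystal n ((r, N) :: B) -> paths n ((r, N) :: B) (T :: b) -> m <= N ->
  X 0 = Phi ((r, N) :: B) (T :: b) ->
  (forall t, mult (X t) = seq_mset (nonempty_rows ((r, N - t) :: B))) ->
  (forall t, t < m -> exists sel, column_removal n r (N - t) (X t) (X t.+1) sel) ->
  [/\ wf_crystal n (columns_crystal B r (N - m)),
    paths n (columns_crystal B r (N - m)) (columns_path N m T b)
  & Phi (columns_crystal B r (N - m)) (columns_path N m T b) = X m].
Proof.
move=> KSS wB pb mN X0 multX remX.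
have wB0 : wf_crystal n B by case/andP: wB.
suff H t : t <= m -> [/\ wf_crystal n (columns_crystal B r (N - t)),
    paths n (columns_crystal B r (N - t)) (columns_path N t T b)
  & Phi (columns_crystal B r (N - t)) (columns_path N t T b) = X t] by exact: H.
elim: t => [_|t IHt tm].
  have N0 : 0 < N by case/andP: wB => /andP[].
  by rewrite /columns_crystal /columns_path subn0 N0 (eq_map (@drop0 _)) map_id.
have [] := IHt (ltnW tm); have Nt : 0 < N - t by rewrite subn_gt0 (leq_trans tm).
rewrite /columns_path /columns_crystal Nt => wt pt Et.
have [wt' pt'] := column_rest KSS wt pt.
have C := column_removal_KSS KSS wt pt; have [sel C'] := remX t tm.
have cE : column_crystal B r (N - t) = columns_crystal B r (N - t.+1).
  by rewrite column_crystalE subnS.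
have pE : column_path (N - t) (map (drop t) T) b = columns_path N t.+1 T b.
  rewrite /column_path /columns_path subnS.
  have -> : (0 < (N - t).-1) = (1 < N - t) by case: (N - t) => [|[]].
  case: ifP => // _; rewrite /other_columns -map_comp; congr (_ :: _).
  apply: eq_map => w /=; rewrite -[t.+1]add1n -drop_drop -[behead _]drop1.
  by rewrite drop1.
rewrite cE pE in wt' pt' C; rewrite Et in C; split=> //.
apply: (column_removal_uniq C C').
by rewrite (KSS_mult KSS wt' pt') multX (nonempty_rows_columns _ _ wB0).
Qed.

Lemma sim_columns_crystal m B r k : 0 < m ->
  sim_crystal m (columns_crystal B r k.-1) =
  columns_crystal (sim_crystal m B) r (m * k - m).
Proof.
move=> m0; have -> : m * k - m = m * k.-1 by rewrite -subn1 mulnBr muln1.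
by rewrite /columns_crystal muln_gt0 m0 /=; case: ifP.
Qed.

Lemma count_flatten_columns (T : tableau) (p : nat) c :
  count_mem c (flatten T) = count_mem c (flatten (map (take p) T))
    + count_mem c (flatten (map (drop p) T)).
Proof.
elim: T => //= w T IHT; rewrite !count_cat IHT -{1}(cat_take_drop p w) count_cat.
by rewrite addnACA.
Qed.

(** After cancellation of the known columns, the first m columns of T' have m times the content of
    the first column of T. Hence they use only its letters, and [full_columns] makes each of them
    equal to it. *)
Lemma sim_tableau_uniq n m r k (T T' : tableau) : 0 < m -> 0 < k ->
  is_tableau n (r, k) T -> is_tableau n (r, m * k) T' ->
  map (drop m) T' = sim_tableau m (other_columns T) ->
  (forall c, count_mem c (flatten T') = m * count_mem c (flatten T)) ->
  T' = sim_tableau m T.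
Proof.
move=> m0 k0 tT tT' dropE cntE.
have [neT hT] := tableau_heads k0 tT.
have /tableauP[sT _ _] := tT; have /tableauP[sT' rT' cT'] := tT'.
have headT : flatten (first_column T) = map (head 0) T.
  elim: T neT {hT tT dropE cntE sT} => //= -[|c w] T IHT //= /andP[_ /IHT ->].
  by rewrite take0.
have takeE : map (take m) T' = map (nseq m) (map (head 0) T).
  apply: full_columns hT _ _ _; first by rewrite !size_map sT sT'.
  - move=> _ /mapP[w /rT'[wm _ _] ->]; rewrite size_take wm.
    by case: ltnP => // mk; apply/eqP; rewrite eqn_leq mk leq_pmulr.
  - rewrite sorted_map; apply: sub_sorted cT'; elim: (m) => [|i IHi] u v //=.
      by rewrite !take0.
    by case: u v => [|c u] [|e v] //= /andP[-> /IHi].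
  - move=> c; rewrite -!has_pred1 !has_count.
    have := cntE c; rewrite (count_flatten_columns T' m) (count_flatten_columns T 1).
    rewrite dropE; have -> : map (drop 1) T = other_columns T.
      by apply: eq_map => w; rewrite drop1.
    rewrite /sim_tableau -stretch_flatten count_stretch mulnDr => /addIn ->.
    by rewrite -/(first_column T) headT muln_gt0 m0.
have T'E : T' = [seq take m w ++ drop m w | w <- T'].
  by rewrite -[LHS]map_id; apply: eq_map => w; rewrite cat_take_drop.
rewrite T'E; apply: (@eq_from_nth _ [::]); rewrite !size_map ?sT'// => i ir.
rewrite (nth_map [::]) ?sT'// (nth_map [::]) ?sT//.
have take_i : take m (nth [::] T' i) = nseq m (head 0 (nth [::] T i)).
  have := congr1 (fun s => nth [::] s i) takeE.
  by rewrite /= (nth_map [::]) ?sT'// (nth_map 0) ?size_map ?sT// (nth_map [::]) ?sT.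
have drop_i : drop m (nth [::] T' i) = stretch m (behead (nth [::] T i)).
  have := congr1 (fun s => nth [::] s i) dropE.
  by rewrite /= (nth_map [::]) ?sT'// (nth_map [::]) ?size_map ?sT// (nth_map [::]) ?sT.
rewrite take_i drop_i.
have /allP/(_ (nth [::] T i)) := neT; rewrite mem_nth ?sT// => /(_ isT)/andP[].
by case: (nth _ T i).
Qed.

Theorem theorem3p3 (n : nat)
    (Phi : crystal -> seq tableau -> rigged_configuration)
    (B : crystal) (m : nat) (b : seq tableau) :
  1 <= n -> is_KSS_bijection n Phi ->
  wf_crystal n B -> 1 <= m -> paths n B b ->
  Phi (sim_crystal m B) (sim_path m b) = sim_RC m (Phi B b).
Proof.
move=> n0 KSS wB m0 pb; have [d] := ubnP (\sum_(q <- B) q.2).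
elim: d B b wB pb => // d IHd [|[r k] B] [|T b] wB pb Bd; try by case: pb.
  rewrite (KSS_empty KSS); apply: rigged_configuration_eq => /=.
    by apply/msetP => q; rewrite enum_mset0 mset_seqE mset0E.
  by apply/msetP => q; rewrite enum_mset0 mset_seqE mset0E.
have [tT tb _] := (paths_cons _ _ _ _ _).1 pb.
have wB0 : wf_crystal n B by case/andP: wB.
have k0 : 0 < k by case/andP: wB => /andP[].
have [wz pz] := column_rest KSS wB pb.
have C := column_removal_KSS KSS wB pb.
set x := Phi ((r, k) :: B) (T :: b) in C *.
set z := Phi (column_crystal B r k) (column_path k T b) in C.
have IHz : Phi (sim_crystal m (column_crystal B r k)) (sim_path m (column_path k T b))
    = sim_RC m z.
  have lt : \sum_(q <- column_crystal B r k) q.2 < \sum_(q <- (r, k) :: B) q.2.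
    by rewrite /column_crystal; case: (ltnP 1 k) => _; rewrite !big_cons /=; clear -k0; lia.
  exact: IHd wz pz (leq_trans lt Bd).
have multx : perm_eq (mult x) ((r, k) :: B).
  by rewrite (KSS_mult KSS wB pb) perm_eq_seq_mset.
have multz : perm_eq (mult z) (nonempty_rows ((r, k.-1) :: B)).
  by rewrite (KSS_mult KSS wz pz) (nonempty_rows_columns _ _ wB0) column_crystalE perm_eq_seq_mset.
have Bpos : all (fun q => 0 < q.2) B by apply: sub_all wB0 => q /andP[].
have [X [X0 Xm multX remX]] := scaled_columns m0 k0 (KSS_RC KSS wB pb)
  (KSS_RC KSS wz pz) C multx multz Bpos.
have wsB := wf_sim m0 wB; have psb := paths_sim m pb.
have [b'' pb'' Eb''] := KSS_surj KSS wsB (RC_sim m0 (KSS_RC KSS wB pb)).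
case: b'' pb'' Eb'' => [|T' b'] pb' Eb'; first by case: pb'.
have mk : m <= m * k by rewrite leq_pmulr.
have [wc pc Ec] := KSS_columns KSS wsB pb' mk (etrans X0 (esym Eb')) multX remX.
have wcE : columns_crystal (map (scale_row m) B) r (m * k - m) =
    sim_crystal m (column_crystal B r k).
  by rewrite column_crystalE sim_columns_crystal.
rewrite wcE in wc pc Ec.
have tail := KSS_inj KSS wc pc (paths_sim m pz) (etrans Ec (etrans Xm (esym IHz))).
rewrite -Eb' /=; congr Phi.
have [tT' tb' _] := (paths_cons _ _ _ _ _).1 pb'.
have bE : b' = sim_path m b.
  move: tail; rewrite /columns_path /column_path.
  have -> : (0 < m * k - m) = (1 < k).
    by rewrite subn_gt0 -{1}[m]muln1 ltn_mul2l m0.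
  by case: ifP => // _ [].
have dropE : map (drop m) T' = sim_tableau m (other_columns T).
  move: tail; rewrite /columns_path /column_path.
  have -> : (0 < m * k - m) = (1 < k).
    by rewrite subn_gt0 -{1}[m]muln1 ltn_mul2l m0.
  (* For k = 1 the factor has disappeared and [tail] says nothing about it, but both sides are lists
     of r empty rows. *)
  case: ltnP => [_ []//|k1 _]; have k_eq1 : k = 1 by clear -k0 k1; lia.
  have /tableauP[sT rT _] := tT; have /tableauP[sT' rT' _] := tT'.
  apply: (@eq_from_nth _ [::]) => [|i]; rewrite !size_map ?sT' ?sT// => ir.
  have iT : i < size T by rewrite sT.
  have iT' : i < size T' by rewrite sT'.
  have [wk _ _] := rT _ (mem_nth [::] iT).
  have [wk' _ _] := rT' _ (mem_nth [::] iT').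
  rewrite (nth_map [::])// (nth_map [::]) ?size_map// (nth_map [::])//.
  rewrite drop_oversize; last by rewrite wk' k_eq1 muln1.
  by apply/esym/eqP; rewrite -size_eq0 size_stretch size_behead wk k_eq1 muln0.
suff -> : T' = sim_tableau m T by rewrite bE.
apply: (sim_tableau_uniq m0 k0 tT tT' dropE) => c.
have [[tbs _] [tb's _]] := (pb, pb').
have cE : forall c, count_mem c (row_word (T' :: b')) = m * count_mem c (row_word (T :: b)).
  apply: (@eq_counts n).
  - rewrite (size_row_word tbs) (size_row_word tb's) big_map big_distrr /=.
    by apply: eq_bigr => q _; rewrite mulnCA.
  - by move=> e; apply: row_word_letters tb's.
  - by move=> e; apply: row_word_letters tbs.
  - move=> a an; rewrite -(gap_weight n0 KSS wsB pb' an) -(gap_weight n0 KSS wB pb an).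
    by rewrite Eb' gap_sim.
(* Only the content of the whole path is known; since b' is already identified, its letters
   cancel. *)
have := cE c; rewrite !row_word_cons !count_cat bE row_word_sim count_stretch mulnDr.
by rewrite !count_tableau_word => /addIn.
Qed.
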